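(* Let $\alpha\in\mathbb{J}$. Assume $\{S(t)\}_{t\ge0}$ is a semigroup in the scale and $P=\{P_1,\ldots,P_n\}\in\mathscr{P}_{\beta_1,\ldots,\beta_n,R}$. Define $\Sigma_{\alpha,\beta_i}:=\mathcal{E}_\alpha\cap\mathcal{R}_{\beta_i}$ and $$\Sigma_{\alpha,\beta_1,\ldots,\beta_n}:=\mathcal{E}_\alpha\cap\mathcal{R}_{\beta_1,\ldots,\beta_n}=\bigcap_{i=1}^n\Sigma_{\alpha,\beta_i}.$$ Then $\alpha\in\Sigma_{\alpha,\beta_1,\ldots,\beta_n}$, and for $$\gamma\in\Sigma_{\alpha,\beta_1,\ldots,\beta_n}=\bigcap_{i=1}^n\{\gamma\in\mathbb{J}:\ \beta_i\stackrel{S(t)}{\leadsto}\gamma,\ \gamma\stackrel{S(t)}{\leadsto}\alpha\ \text{ and }\ \mathtt{r}(\gamma)\in[\mathtt{r}(\beta_i),\mathtt{r}(\alpha)]\},$$ $\{S_P(t)\}_{t\ge0}$ is a semigroup in $X^\gamma$ satisfying, for some constants $M_0=M_0(\gamma)$, $\omega_\gamma$, $$\|S_P(t)\|_{\mathcal{L}(X^\gamma)}\le M_0e^{\omega_\gamma t},\quad t\ge0,$$ and for $u_0\in X^\gamma$ $$\lim_{t\to0^+}\|S_P(t)u_0-S(t)u_0\|_{X^\gamma}=0.$$ For $\gamma'\in\mathcal{R}_{\beta_1,\ldots,\beta_n}$ such that $\gamma\stackrel{S(t)}{\dashrightarrow}\gamma'$ and $T>0$ there exists a constant $M=M(\gamma,\gamma',T)$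 such that $$\|S_P(t)\|_{\mathcal{L}(X^\gamma,X^{\gamma'})}\le\begin{cases}\dfrac{M}{t^{d(\gamma',\gamma)}}, & 0<t\le T,\\ Me^{\omega_\gamma t}, & T<t.\end{cases}$$ In particular, for any $\omega>\omega_\gamma$ there exists a constant $M_1=M_1(\gamma,\gamma')$ independent of $t>0$ such that $$\|S_P(t)\|_{\mathcal{L}(X^\gamma,X^{\gamma'})}\le\frac{M_1}{t^{d(\gamma',\gamma)}}e^{\omega t},\quad t>0.$$
   Context: Scale of spaces: $\mathbb{J}$ is a set of indices and $\{X^\gamma\}_{\gamma\in\mathbb{J}}$ a family of Banach spaces (norms $\|\cdot\|_\gamma$) that is topologically consistent: if a sequence in $X^\gamma\cap X^{\tilde\gamma}$ converges in both spaces, the limits coincide. A map $\mathtt{r}:\mathbb{J}\to\mathbb{R}$ (regularity index) is given and $d(\tilde\gamma,\gamma):=\mathtt{r}(\tilde\gamma)-\mathtt{r}(\gamma)$. $\{S(t)\}_{t\ge0}$ is a family of linear operators with $S(0)=I$ defined consistently on the spaces of the scale (if $u_0\in X^\gamma\cap X^{\tilde\gamma}$, the values of $S(t)u_0$ in the two spaces coincide). Smoothing: $\gamma\stackrel{S(t)}{\dashrightarrow}\tilde\gamma$ means that $d(\tilde\gamma,\gamma)\ge0$ and for any $T>0$ there is a constant $M=M(\gamma,\tilde\gamma,T)$ (nondecreasing in $T$) with $\|S(t)\|_{\mathcal{L}(X^\gamma,X^{\tilde\gamma})}\le M t^{-d(\tilde\gamma,\gamma)}$ for $0<t\le T$. $\gamma\stackrel{S(t)}{\leadsto}\tilde\gamma$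 means that in addition $(0,\infty)\ni t\mapsto S(t)u_0\in X^{\tilde\gamma}$ is continuous for each $u_0\in X^\gamma$. $\{S(t)\}$ is a semigroup in the scale if for each $\gamma\in\mathbb{J}$ it is a (not necessarily $C^0$) semigroup in $X^\gamma$ and $\gamma\stackrel{S(t)}{\leadsto}\gamma$. Perturbations: for fixed $\alpha\in\mathbb{J}$, $R>0$ and $\beta\in\mathbb{J}$, $\mathscr{P}_{\beta,R}$ is the set of $P\in\mathcal{L}(X^\alpha,X^\beta)$ with $\|P\|_{\mathcal{L}(X^\alpha,X^\beta)}\le R$, where $\alpha,\beta$ satisfy $0\le d(\alpha,\beta)<1$ and $\beta\stackrel{S(t)}{\leadsto}\alpha$. $P=\{P_1,\ldots,P_n\}\in\mathscr{P}_{\beta_1,\ldots,\beta_n,R}$ means $P_i\in\mathscr{P}_{\beta_i,R}$ for each $i$. Index sets: $\mathcal{E}_\alpha:=\{\gamma\in\mathbb{J}:\mathtt{r}(\gamma)\in(\mathtt{r}(\alpha)-1,\mathtt{r}(\alpha)]\text{ and }\gamma\stackrel{S(t)}{\leadsto}\alpha\}$; $\mathcal{R}_\beta:=\{\gamma'\in\mathbb{J}:\mathtt{r}(\gamma')\in[\mathtt{r}(\beta),\mathtt{r}(\beta)+1)\text{ and }\beta\stackrel{S(t)}{\leadsto}\gamma'\}$; $\mathcal{R}_{\beta_1,\ldots,\beta_n}:=\bigcap_i\mathcal{R}_{\beta_i}$. Perturbed family: $\mathcal{L}^\infty_{\alpha,\varepsilon}$ is the set of strongly measurable $\varphi:(0,\infty)\to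 X^\alpha$ with $\sup_{t\in(0,T]}t^\varepsilon\|\varphi(t)\|_\alpha<\infty$ for every $T>0$. For $\gamma\in\mathcal{E}_\alpha$ and $u_0\in X^\gamma$ there is a unique $u\in\mathcal{L}^\infty_{\alpha,d(\alpha,\gamma)}$ with $u(t)=S(t)u_0+\sum_{i=1}^n\int_0^tS(t-\tau)P_iu(\tau)\,d\tau$ for all $t>0$; $S_P(t)u_0:=u(t)$ for $t>0$ and $S_P(0)u_0:=u_0$. *)

(* Defs.v *)
From HB Require Import structures.
From mathcomp Require Import all_boot all_order all_algebra.
From mathcomp Require Import all_classical all_reals all_analysis.

Set Implicit Arguments.
Unset Strict Implicit.
Unset Printing Implicit Defensive.

Import Order.TTheory GRing.Theory Num.Theory.
Import numFieldNormedType.Exports.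

#[global] Open Scope classical_set_scope.
#[global] Open Scope ring_scope.

(* Intersections of the spaces make sense because every space is linearly
   embedded in one vector space without topology: x in X g and y in X g' are
   the same element when emb g x = emb g' y. *)
Record banach_scale (R : realType) := BanachScale {
  scale_index : Type ;
  ambient : lmodType R ;
  scale_space :> scale_index -> completeNormedModType R ;
  emb : forall g, {linear scale_space g -> ambient} ;
  rindex : scale_index -> R ;
  emb_inj : forall g, injective (emb g) ;
  emb_consistent : forall g g' (x : nat -> scale_space g)
      (y : nat -> scale_space g')
      (a : scale_space g) (b : scale_space g'),
    (forall k, emb g (x k) = emb g' (y k)) ->
    x @ \oo --> a -> y @ \oo --> b -> emb g a = emb g' b }.

Arguments emb {R} _ _.

Definition dreg (R : realType) (X : banach_scale R) (g' g : scale_index X) :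
    R :=
  rindex g' - rindex g.

(* The value of S(t) at u in X g is only required to lie in the ambient
   space; that it lies in X g' is part of the smoothing and semigroup
   properties. *)
Record op_family (R : realType) (X : banach_scale R) := OpFamily {
  op_at :> forall g, R -> X g -> ambient X ;
  op_linear : forall g (t : R), 0 <= t -> linear (@op_at g t) ;
  op_id : forall g u, @op_at g 0 u = emb X g u ;
  op_consistent : forall g g' (t : R) (u : X g) (v : X g'), 0 <= t ->
    emb X g u = emb X g' v -> @op_at g t u = @op_at g' t v }.

Arguments op_at {R X} _ _ _ _.

Section Bochner.
Context {R : realType} {V : normedModType R}.
Implicit Types (D : set R) (s f : R -> V).

Local Notation mu := (@lebesgue_measure R).

Definition simple_fun s :=
  finite_set (range s) /\ forall x : V, measurable (s @^-1` [set x]).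

Definition simple_integrable D s :=
  simple_fun s /\ forall x : V, x != 0 -> (mu (D `&` s @^-1` [set x]) < +oo)%E.

Definition simple_integral D s : V :=
  \sum_(x \in range s) fine (mu (D `&` s @^-1` [set x])) *: x.

(* Almost everywhere limits make no difference between Borel and Lebesgue
   measurable simple functions. *)
Definition strongly_measurable D f :=
  exists2 s : nat -> R -> V, forall k, simple_fun (s k) &
    {ae mu, forall x, D x -> s k x @[k --> \oo] --> f x}.

Definition is_bochner_integral D f (v : V) :=
  exists s : nat -> R -> V,
    [/\ forall k, simple_integrable D (s k),
        {ae mu, forall x, D x -> s k x @[k --> \oo] --> f x},
        (\int[mu]_(x in D) (`|f x - s k x|)%:E)%E @[k --> \oo] --> 0%E &
        simple_integral D (s k) @[k --> \oo] --> v].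

End Bochner.

Definition opnorm (R : realType) (V W : normedModType R) (A : V -> W) :
    \bar R :=
  ereal_sup [set (`|A u|)%:E | u in [set u | `|u| <= 1]].

Section Scale.
Context {R : realType} {X : banach_scale R}.
Implicit Types g : scale_index X.

(* F belongs to L(X g, X g') and has norm at most c there. *)
Definition op_bounded g g' (F : X g -> ambient X) (c : R) :=
  exists A : {linear X g -> X g'},
    [/\ forall u, emb X g' (A u) = F u, continuous A & (opnorm A <= c%:E)%E].

Definition semigroup_in g (F : R -> X g -> ambient X) :=
  exists A : R -> {linear X g -> X g},
    [/\ forall t : R, 0 <= t -> continuous (A t),
        forall (t : R) u, 0 <= t -> emb X g (A t u) = F t u,
        forall u, A 0 u = u &
        forall (t s : R) u, 0 <= t -> 0 <= s -> A (t + s) u = A t (A s u)].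

(* The dashed arrow of the paper. *)
Definition smooths (S : op_family X) g g' :=
  0 <= dreg g' g /\
  exists M : R -> R,
    (forall T T' : R, 0 < T -> T <= T' -> M T <= M T') /\
    (forall T t : R, 0 < t -> t <= T ->
      op_bounded g' (S g t) (M T * t `^ (- dreg g' g))).

(* The wavy arrow of the paper. *)
Definition csmooths (S : op_family X) g g' :=
  smooths S g g' /\
  forall u : X g, exists f : R -> X g',
    (forall t : R, 0 < t -> emb X g' (f t) = S g t u) /\
    {within `]0, +oo[, continuous f}.

Definition semigroup_in_scale (S : op_family X) :=
  forall g, semigroup_in (S g) /\ csmooths S g g.

Definition pert_class (S : op_family X) (alpha beta : scale_index X) (rho : R) :
    set {linear X alpha -> X beta} :=
  [set P : {linear X alpha -> X beta} |
    [/\ 0 <= dreg alpha beta < 1, csmooths S beta alpha, continuous P &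
        (opnorm P <= rho%:E)%E]].

Definition E_set (S : op_family X) (alpha : scale_index X) :
    set (scale_index X) :=
  [set g | (rindex g \in `]rindex alpha - 1, rindex alpha]) /\
    csmooths S g alpha].

Definition R_set (S : op_family X) (beta : scale_index X) :
    set (scale_index X) :=
  [set g | (rindex g \in `[rindex beta, rindex beta + 1[) /\
    csmooths S beta g].

Definition R_sets (S : op_family X) n (beta : 'I_n -> scale_index X) :
    set (scale_index X) :=
  \bigcap_(i in [set: 'I_n]) R_set S (beta i).

Definition Sigma (S : op_family X) (alpha beta : scale_index X) :
    set (scale_index X) :=
  E_set S alpha `&` R_set S beta.

Definition Sigmas (S : op_family X) (alpha : scale_index X) n
    (beta : 'I_n -> scale_index X) : set (scale_index X) :=
  E_set S alpha `&` R_sets S beta.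

Definition Linfty_loc g (eps : R) : set (R -> X g) :=
  [set phi : R -> X g | strongly_measurable `]0, +oo[ phi /\
    forall T : R, 0 < T ->
      (ereal_sup [set (t `^ eps * `|phi t|)%:E | t in [set t | (0 < t <= T)%R]]
         < +oo)%E].

(* On the set D, F takes its values in X g, and v is its Bochner integral over
   D in that space. *)
Definition integral_in g (D : set R) (F : R -> ambient X) (v : X g) :=
  exists2 f : R -> X g, forall t, D t -> emb X g (f t) = F t &
    is_bochner_integral D f v.

Section Perturbation.
Variables (S : op_family X) (alpha : scale_index X) (n : nat).
Variables (beta : 'I_n -> scale_index X).
Variables (P : forall i, {linear X alpha -> X (beta i)}).

Definition mild_solution g (u0 : X g) : set (R -> X alpha) :=
  [set u | Linfty_loc (dreg alpha g) u /\
    forall t : R, 0 < t -> exists w : 'I_n -> X alpha,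
      (forall i, integral_in `]0, t[
         (fun tau => S (beta i) (t - tau) (P i (u tau))) (w i)) /\
      emb X alpha (u t) = S g t u0 + \sum_i emb X alpha (w i)].

(* For g in E_set S alpha the mild solution exists and is unique on the
   positive half-line, so that xget selects it; its values at t <= 0, on which
   mild_solution puts no constraint, are not used. *)
Definition perturbed g (t : R) (u0 : X g) : ambient X :=
  if t == 0 then emb X g u0
  else emb X alpha (xget (fun=> 0) (mild_solution u0) t).

End Perturbation.
End Scale.

Arguments pert_class {R X} S alpha beta rho _.

(* Main.v *)
Require Import Defs.
From HB Require Import structures.
From mathcomp Require Import all_boot all_order all_algebra.
From mathcomp Require Import all_classical all_reals all_analysis.
From mathcomp Require Import measurable_realfun.
From mathcomp Require Import ring lra.
Import Order.TTheory GRing.Theory Num.Theory.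
Import numFieldNormedType.Exports.

(** The perturbed family is given by the variation of constants formula
    [u t = S t u0 + \sum_i \int_0^t S (t - tau) (P i (u tau))] with [u0] in [X g].
    By smoothing, the kernel is at most a constant times
    [(t - tau) `^ (- a) * tau `^ (- eps)], where the regularity [a] lost by [P i]
    and the regularity [eps] between [X g] and [X alpha] both lie below 1. The
    Beta function estimate [integral_beta_weight] then shows that an integral
    term is smaller than the free evolution by the factor [t `^ (1 - a)].
    Everything rests on this gain.

    Existence, uniqueness, bounds. In the norm with weight
    [t `^ eps * expR (- lambda * t)] on a bounded time interval, with [lambda]
    large, the integral terms are a contraction with factor one half
    ([duhamel_contraction]). Hence the Dyson-Phillips series converges to a
    continuous solution ([solution_eq]) with the singularity of the free
    evolution at 0 ([solution_le]), and two solutions in the larger class of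
    strongly measurable functions coincide ([mild_unique]). The latter is what
    identifies the solution chosen by the perturbed family ([perturbedE]).

    Integrals. Once solutions are known to be continuous, the Bochner integrals
    are limits of Riemann sums ([riemann_sum_cvg]). Riemann sums commute with
    bounded operators, and they are the same ambient vectors whatever the space
    of the scale in which they are formed, so the topological consistency of
    the scale equates the integrals taken in different spaces
    ([duhamel_consistent]). It follows that the perturbed family maps [X g] into
    every [X h] reached by the free evolution both from [X g] and from the ranges
    of the [P i], with the bound of the free evolution on bounded time intervals
    ([perturbed_in_le]), and that its difference with the free evolution tends
    to 0 in [X g] at the origin ([duhamel_solution_cvg0]).

    Semigroup and growth. A translate of a solution solves the equation with the
    value reached as new initial value, hence is the solution with that initial
    value ([solution_shift]). The exponential bound in [X g] comes from the bound
    on the unit interval and the semigroup law, and the one into [X h] by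
    smoothing during the last stretch of time only. *)

Set Implicit Arguments.
Unset Strict Implicit.
Unset Printing Implicit Defensive.

Local Open Scope classical_set_scope.
Local Open Scope ring_scope.

(** * Simple functions and their integrals *)

Section SimpleFunctions.
Context {R : realType}.
Local Notation mu := (@lebesgue_measure R).

(** A value of [g \o p] is taken on the disjoint union of the level sets of [p]
    on which [g] has that value, and the measure is additive. Taking for [p] a
    pair of simple functions makes the simple integral linear. *)
Lemma simple_integral_comp (V : normedModType R) (T : choiceType)
    (p : R -> T) (g : T -> V) (D : set R) :
  measurable D -> (mu D < +oo)%E -> finite_set (range p) ->
  (forall y, measurable (p @^-1` [set y])) ->
  simple_integral D (g \o p) =
    \sum_(y \in range p) fine (mu (D `&` p @^-1` [set y])) *: g y.
Proof.
move=> mD Dfin finp mp; rewrite /simple_integral.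
have fing : finite_set (range (g \o p)).
  by rewrite -(image_comp p g); apply: finite_image.
have mDp y : measurable (D `&` p @^-1` [set y]) by exact: measurableI.
have fin_mu y : mu (D `&` p @^-1` [set y]) \is a fin_num.
  rewrite ge0_fin_numE//; move: Dfin; apply: le_lt_trans.
  by apply: le_measure; rewrite ?inE//; exact: mDp.
have split_level z : fine (mu (D `&` (g \o p) @^-1` [set z])) =
    \sum_(y \in range p) if g y == z then fine (mu (D `&` p @^-1` [set y])) else 0.
  have -> : D `&` (g \o p) @^-1` [set z] =
      \bigcup_(y in range p `&` g @^-1` [set z]) (D `&` p @^-1` [set y]).
    apply/seteqP; split=> [x [Dx gpx]|x [y [_ gy] [Dx /= pxy]]].
      by exists (p x); split=> //; exists x.
    by split=> //=; rewrite pxy.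
  have finI : finite_set (range p `&` g @^-1` [set z]) by exact: finite_setIl.
  have triv : trivIset (range p `&` g @^-1` [set z])
      (fun y => D `&` p @^-1` [set y]).
    by move=> y1 y2 _ _ [x [[_ <-] [_ <-]]].
  rewrite measure_fin_bigcup; [|exact: finI|exact: triv|by move=> y _; exact: mDp].
  rewrite fsbig_mkcondr !fsbig_finite//= -sum_fine; last first.
    by move=> y _; case: ifP.
  apply: eq_bigr => y _; rewrite -[if g y == z then _ else _]/(if _ then _ else _).
  have -> : (y \in g @^-1` [set z]) = (g y == z) by apply/idP/eqP; rewrite inE.
  by case: ifP.
under eq_fsbigr do rewrite split_level.
transitivity (\sum_(z \in range (g \o p)) \sum_(y \in range p)
    if g y == z then fine (mu (D `&` p @^-1` [set y])) *: g y else 0).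
  apply: eq_fsbigr => z _; rewrite !fsbig_finite//= scaler_suml.
  by apply: eq_bigr => y _; case: ifPn => [/eqP ->//|]; rewrite scale0r.
rewrite exchange_fsbig//; apply: eq_fsbigr => y; rewrite inE => -[x _ <-].
rewrite -(fsbig_widen [set g (p x)])/=; last 2 first.
- by move=> _ ->; exists x.
- by move=> z [_ /= /eqP]; rewrite eq_sym => /negbTE ->.
by rewrite fsbig_set1 eqxx.
Qed.

Context {V : normedModType R}.
Implicit Types (D : set R) (s r : R -> V).

(** Lets an expression in two simple functions be treated as a function of a
    single one. *)
Lemma simple_fun_pair s r : simple_fun s -> simple_fun r ->
  finite_set (range (fun x => (s x, r x))) /\
  forall y, measurable ((fun x => (s x, r x)) @^-1` [set y]).
Proof.
move=> [fins ms] [finr mr]; split.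
  apply: (sub_finite_set _ (finite_setX fins finr)) => _ [x _ <-].
  by split; exists x.
case=> y z; rewrite [X in measurable X](_ : _ = s @^-1` [set y] `&` r @^-1` [set z]).
  exact: measurableI.
by apply/seteqP; split=> [x [<- <-]//|x [/= -> ->]].
Qed.

Lemma simple_fun_comp (T : choiceType) (p : R -> T) (g : T -> V) :
  finite_set (range p) -> (forall y, measurable (p @^-1` [set y])) ->
  simple_fun (g \o p).
Proof.
move=> finp mp; split; first by rewrite -(image_comp p g); apply: finite_image.
move=> z; rewrite [X in measurable X](_ : _ =
  \bigcup_(y in range p `&` g @^-1` [set z]) p @^-1` [set y]); last first.
  apply/seteqP; split=> [x /= gpx|x [y [_ gy] /= pxy]]; last by rewrite /= pxy.
  by exists (p x) => //; split=> //; exists x.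
by apply: fin_bigcup_measurable => //; exact: finite_setIl.
Qed.

Lemma simple_fun_lin s r (k : R) : simple_fun s -> simple_fun r ->
  simple_fun (fun x => k *: s x + r x).
Proof.
move=> ss sr; have [fp mp] := simple_fun_pair ss sr.
exact: (simple_fun_comp (fun y : V * V => k *: y.1 + y.2) fp mp).
Qed.

Lemma simple_integral_lin D s r (k : R) : measurable D -> (mu D < +oo)%E ->
  simple_fun s -> simple_fun r ->
  simple_integral D (fun x => k *: s x + r x) =
    k *: simple_integral D s + simple_integral D r.
Proof.
move=> mD Dfin ss sr; have [fp mp] := simple_fun_pair ss sr.
pose p x := (s x, r x).
rewrite (simple_integral_comp (fun y : V * V => k *: y.1 + y.2) mD Dfin fp mp).
rewrite -[s]/(fst \o p) -[r]/(snd \o p).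
rewrite !(simple_integral_comp _ mD Dfin fp mp).
rewrite !fsbig_finite//= scaler_sumr -big_split/=; apply: eq_bigr => y _.
by rewrite scalerDr !scalerA mulrC.
Qed.

Lemma simple_funB s r : simple_fun s -> simple_fun r ->
  simple_fun (fun x => s x - r x).
Proof.
move=> ss sr; have := simple_fun_lin (-1) sr ss.
by congr simple_fun; apply/funext => x; rewrite scaleN1r addrC.
Qed.

Lemma simple_integralB D s r : measurable D -> (mu D < +oo)%E ->
  simple_fun s -> simple_fun r ->
  simple_integral D (fun x => s x - r x) =
    simple_integral D s - simple_integral D r.
Proof.
move=> mD Dfin ss sr; rewrite addrC -scaleN1r -simple_integral_lin//.
by congr simple_integral; apply/funext => x; rewrite scaleN1r addrC.
Qed.

Lemma simple_fun_indic (A : set R) (c : V) : measurable A ->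
  simple_fun (fun x => \1_A x *: c).
Proof.
move=> mA; pose p x : bool := x \in A.
have -> : (fun x => \1_A x *: c) = (fun b : bool => b%:R *: c) \o p by [].
apply: simple_fun_comp => [|[]].
- by apply: (@sub_finite_set _ _ [set true; false]) => // -[] _; [left|right].
- rewrite [X in measurable X](_ : _ = A)//.
  by apply/seteqP; split=> x; rewrite /p/=; [exact: set_mem|exact: mem_set].
- rewrite [X in measurable X](_ : _ = ~` A); first exact: measurableC.
  apply/seteqP; split=> x; rewrite /p/=.
    by move=> /negbT; rewrite notin_setE.
  by move=> xA; apply/negbTE; rewrite notin_setE.
Qed.

Lemma simple_integral_indic D (A : set R) (c : V) : measurable D ->
  (mu D < +oo)%E -> measurable A ->
  simple_integral D (fun x => \1_A x *: c) = fine (mu (D `&` A)) *: c.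
Proof.
move=> mD Dfin mA; have [sA mAx] := @simple_fun_indic A c mA.
have [->|c0] := eqVneq c 0.
  rewrite scaler0 /simple_integral fsbig1// => _ [x _ <-].
  by rewrite !scaler0.
rewrite /simple_integral (fsbig_widen _ [set 0; c])/=; last 2 first.
- move=> _ [x _ <-]; rewrite indicE.
  by case: (x \in A); [right; rewrite scale1r|left; rewrite scale0r].
- move=> z [_ /= zA]; rewrite preimage10 ?setI0 ?measure0 ?scale0r//.
rewrite fsbigU//=; last by move=> z [/= -> /esym/eqP]; rewrite (negbTE c0).
rewrite !fsbig_set1 scaler0 add0r; congr (fine (mu (D `&` _)) *: c).
apply/seteqP; split=> x; rewrite /= indicE.
  case: (boolP (x \in A)); rewrite ?inE// => _ /esym/eqP.
  by rewrite scale0r (negbTE c0).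
by move=> xA; rewrite mem_set// scale1r.
Qed.

Lemma simple_fun_sum n (s : 'I_n -> R -> V) : (forall i, simple_fun (s i)) ->
  simple_fun (fun x => \sum_i s i x).
Proof.
elim: n s => [|n IH] s ss.
  under [X in simple_fun X]eq_fun do rewrite big_ord0.
  have := @simple_fun_indic set0 0 measurable0.
  by congr simple_fun; apply/funext => x; rewrite scaler0.
under [X in simple_fun X]eq_fun do rewrite big_ord_recl -[X in X + _]scale1r.
by apply: simple_fun_lin => //; exact: IH.
Qed.

Lemma simple_integral_sum D n (s : 'I_n -> R -> V) : measurable D ->
  (mu D < +oo)%E -> (forall i, simple_fun (s i)) ->
  simple_integral D (fun x => \sum_i s i x) = \sum_i simple_integral D (s i).
Proof.
move=> mD Dfin; elim: n s => [|n IH] s ss.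
  rewrite big_ord0 /simple_integral fsbig1// => _ [x _ <-].
  by rewrite big_ord0 scaler0.
rewrite big_ord_recl -(IH (fun i => s (lift ord0 i)))//.
rewrite -[X in X + _]scale1r -simple_integral_lin//; last exact: simple_fun_sum.
by congr simple_integral; apply/funext => x; rewrite big_ord_recl scale1r.
Qed.

Lemma simple_fun_norm s : simple_fun s -> measurable_fun setT (fun x => `|s x|).
Proof.
move=> [fins ms] _ B _; rewrite setTI.
rewrite [X in measurable X](_ : _ =
  \bigcup_(y in range s `&` (fun y => `|y|) @^-1` B) s @^-1` [set y]); last first.
  apply/seteqP; split=> [x /= Bx|x [y [_ By] /= sxy]]; last by rewrite /= sxy.
  by exists (s x) => //; split=> //; exists x.
by apply: fin_bigcup_measurable => //; exact: finite_setIl.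
Qed.

Lemma simple_fun_normE s : simple_fun s ->
  forall x, `|s x| = \sum_(y \in range s) \1_(s @^-1` [set y]) x * `|y|.
Proof.
move=> ss x; rewrite -(fsbig_widen [set s x])/=; last 2 first.
- by move=> _ ->; exists x.
- move=> z [_ /= zs]; rewrite indicE memNset ?mul0r// => /= sx.
  by apply: zs.
by rewrite fsbig_set1 indicE mem_set ?mul1r.
Qed.

(** The triangle inequality for the finite sum, whose terms are the integrals
    of the indicator functions adding up to the norm of [s]. *)
Lemma norm_simple_integral D s : measurable D -> (mu D < +oo)%E ->
  simple_fun s ->
  (`|simple_integral D s|%:E <= \int[mu]_(x in D) `|s x|%:E)%E.
Proof.
move=> mD Dfin ss; have [fins ms] := ss.
under eq_integral do rewrite simple_fun_normE// fsbig_finite//= -sumEFin.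
rewrite ge0_integral_sum//; last first.
  move=> y; apply/measurable_EFinP; apply: measurable_funM => //.
  by apply: measurable_indic; exact: ms.
rewrite /simple_integral fsbig_finite//=.
have -> : (\sum_(y <- finmap.enum_fset (fset_set (range s)))
    \int[mu]_(x in D) (\1_(s @^-1` [set y]) x * `|y|)%:E =
    \sum_(y <- finmap.enum_fset (fset_set (range s)))
    (`|fine (mu (D `&` s @^-1` [set y])) *: y|)%:E)%E.
  apply: eq_bigr => y _; under eq_integral do rewrite EFinM muleC.
  have iA : measurable_fun D (fun x => (\1_(s @^-1` [set y]) x : R)%:E).
    by apply/measurable_EFinP; apply: measurable_indic; exact: ms.
  rewrite ge0_integralZl//.
  rewrite integral_indic; [|exact: mD|exact: ms].
  rewrite normrZ ger0_norm ?fine_ge0// EFinM fineK; last first.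
    rewrite ge0_fin_numE//; move: Dfin; apply: le_lt_trans.
    have mDs : measurable (D `&` s @^-1` [set y]).
      by apply: measurableI => //; exact: ms.
    by apply: le_measure; rewrite ?inE.
  by rewrite muleC setIC.
by rewrite sumEFin lee_fin ler_norm_sum.
Qed.

End SimpleFunctions.

(** * Bochner integrals *)

Lemma subrACA (V : zmodType) (a b c d : V) : a - b - (c - d) = a - c - (b - d).
Proof. by rewrite opprD addrACA -opprD. Qed.

Section Bochner.
Context {R : realType}.
Local Notation mu := (@lebesgue_measure R).

(** The integral of a nonnegative function, measurable or not, is a supremum
    over the simple functions below it. This is what allows the exceptional null
    set of an almost everywhere limit to be discarded. *)
Lemma integral_subset (D E : set R) (f : R -> \bar R) :
  E `<=` D -> (forall x, D x -> (0 <= f x)%E) ->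
  (\int[mu]_(x in E) f x <= \int[mu]_(x in D) f x)%E.
Proof.
move=> ED f0; rewrite !ge0_integralE//; last by move=> x /ED; exact: f0.
apply: ereal_sup_le => _ [s /= sf <-]; exists s => // x.
apply: le_trans (sf x) _; rewrite !patchE.
case: ifPn => [/[!inE] /ED xD|_]; first by rewrite mem_set.
by case: ifPn => // /[!inE]; exact: f0.
Qed.

Lemma lt_near0 (u : (\bar R) ^nat) (e : R) : 0 < e ->
  u @ \oo --> 0%E -> \forall k \near \oo, (u k < e%:E)%E.
Proof.
move=> e0 u0; apply: (u0 [set x | x < e%:E]%E).
apply: open_nbhs_nbhs; split; first exact: open_ereal_lt_ereal.
by rewrite /= lte_fin.
Qed.

Lemma norm_near0 (V : normedModType R) (u : V ^nat) (v : V) (e : R) : 0 < e ->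
  u @ \oo --> v -> \forall k \near \oo, `|v - u k| < e.
Proof. by move=> e0 /cvgrPdist_lt; apply. Qed.

Section NormedSpace.
Context {V : normedModType R}.
Implicit Types (D N : set R) (f g s r : R -> V).

Lemma simple_integral_setD D N s : measurable D -> (mu D < +oo)%E ->
  measurable N -> mu N = 0%E -> simple_fun s ->
  simple_integral (D `\` N) s = simple_integral D s.
Proof.
move=> mD Dfin mN N0 [_ ms]; apply: eq_fsbigr => y _; congr (fine _ *: _).
have mDs : measurable (D `&` s @^-1` [set y]).
  by apply: measurableI => //; exact: ms.
have -> : mu (D `&` s @^-1` [set y]) = (mu ((D `&` s @^-1` [set y]) `\` N) +
    mu ((D `&` s @^-1` [set y]) `&` N))%E by exact: measureDI.
have -> : mu ((D `&` s @^-1` [set y]) `&` N) = 0%E.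
  have mDsN : measurable ((D `&` s @^-1` [set y]) `&` N) by exact: measurableI.
  by apply: subset_measure0 N0 => //; exact: subIsetr.
by rewrite adde0; congr (mu _); apply/seteqP; split=> x /=; tauto.
Qed.

Lemma measurable_norm_sub D (s : nat -> R -> V) f r :
  measurable D -> (forall k, simple_fun (s k)) ->
  (forall x, D x -> s k x @[k --> \oo] --> f x) -> simple_fun r ->
  measurable_fun D (fun x => `|f x - r x|).
Proof.
move=> mD ss sf sr; apply: (@measurable_fun_cvg _ _ _ _ (fun k x => `|s k x - r x|)).
  by move=> k; apply: measurable_funTS; apply: simple_fun_norm; exact: simple_funB.
by move=> x Dx; apply: cvg_norm; apply: cvgB; [exact: sf|exact: cvg_cst].
Qed.

Lemma simple_integral_dist D s r : measurable D -> (mu D < +oo)%E ->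
  simple_fun s -> simple_fun r ->
  (`|simple_integral D s - simple_integral D r|%:E <=
    \int[mu]_(x in D) `|s x - r x|%:E)%E.
Proof.
move=> mD Dfin ss sr; rewrite -simple_integralB//.
by apply: norm_simple_integral => //; exact: simple_funB.
Qed.

(** Both defining sequences converge off a common Borel null set. Removing that
    set preserves the integrals of simple functions and increases no other
    integral, and on the remainder all the norms are measurable. Uniqueness,
    norm bounds and contraction estimates all come from this lemma. *)
Lemma bochner_dist_le D f g v w (h : R -> R) :
  measurable D -> (mu D < +oo)%E ->
  is_bochner_integral D f v -> is_bochner_integral D g w ->
  measurable_fun D h -> (forall x, D x -> `|f x - g x| <= h x) ->
  (`|v - w|%:E <= \int[mu]_(x in D) (h x)%:E)%E.
Proof.
move=> mD Dfin [s [ss [N1 [mN1 N10 N1s]] is0 sv]] [r [sr [N2 [mN2 N20 N2r]] ir0 rw]].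
move=> mh fgh; pose N := N1 `|` N2; pose E := D `\` N.
have mN : measurable N by exact: measurableU.
have N0 : mu N = 0%E.
  apply/eqP; rewrite eq_le measure_ge0 andbT.
  rewrite -[0%E](adde0 0%E) -[X in (_ <= X + _)%E]N10 -[X in (_ <= _ + X)%E]N20.
  exact: measureU2.
have mE : measurable E by exact: measurableD.
have Efin : (mu E < +oo)%E.
  by move: Dfin; apply: le_lt_trans; apply: le_measure; rewrite ?inE//; exact: subDsetl.
have ED : E `<=` D by exact: subDsetl.
have ss' k : simple_fun (s k) by have [] := ss k.
have sr' k : simple_fun (r k) by have [] := sr k.
have sE x : E x -> s k x @[k --> \oo] --> f x.
  move=> [Dx Nx]; apply: contrapT => sfx; apply: Nx; left; apply: N1s => /= sf.
  exact/sfx/sf.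
have rE x : E x -> r k x @[k --> \oo] --> g x.
  move=> [Dx Nx]; apply: contrapT => sfx; apply: Nx; right; apply: N2r => /= sf.
  exact/sfx/sf.
have h0 x : D x -> (0 <= (h x)%:E)%E.
  by move=> Dx; rewrite lee_fin; apply: le_trans (fgh x Dx).
apply/lee_addgt0Pr => e e0.
have e40 : 0 < e / 4 by rewrite divr_gt0.
near \oo => k.
have -> : v - w = (v - simple_integral D (s k)) - (w - simple_integral D (r k)) +
   (simple_integral D (s k) - simple_integral D (r k)).
  by rewrite subrACA subrK.
have vk : `|v - simple_integral D (s k)| < e / 4.
  by near: k; exact: norm_near0.
have wk : `|w - simple_integral D (r k)| < e / 4.
  by near: k; exact: norm_near0.
have sk : (\int[mu]_(x in D) `|f x - s k x|%:E < (e / 4)%:E)%E.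
  by near: k; exact: lt_near0.
have rk : (\int[mu]_(x in D) `|g x - r k x|%:E < (e / 4)%:E)%E.
  by near: k; exact: lt_near0.
have mfs : measurable_fun E (fun x => `|f x - s k x|).
  exact: (measurable_norm_sub mE ss' sE).
have mgr : measurable_fun E (fun x => `|g x - r k x|).
  exact: (measurable_norm_sub mE sr' rE).
have mhE : measurable_fun E h by exact: measurable_funS mh.
have msr : measurable_fun E (fun x => `|s k x - r k x|).
  by apply: measurable_funTS; apply: simple_fun_norm; exact: simple_funB.
have key : (`|simple_integral D (s k) - simple_integral D (r k)|%:E <=
    \int[mu]_(x in D) (h x)%:E + ((e / 4)%:E + (e / 4)%:E))%E.
  rewrite -(simple_integral_setD mD Dfin mN N0 (ss' k)).
  rewrite -(simple_integral_setD mD Dfin mN N0 (sr' k)).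
  apply: le_trans (simple_integral_dist mE Efin (ss' k) (sr' k)) _.
  apply: (@le_trans _ _ (\int[mu]_(x in E) ((h x)%:E +
      (`|f x - s k x|%:E + `|g x - r k x|%:E))%E)%E).
    apply: ge0_le_integral => //.
    - exact/measurable_EFinP.
    - apply: emeasurable_funD; first exact/measurable_EFinP.
      by apply: emeasurable_funD; exact/measurable_EFinP.
    - move=> x Ex; rewrite -!EFinD lee_fin.
      have -> : s k x - r k x = (f x - g x) - ((f x - s k x) - (g x - r k x)).
        by rewrite [f x - s k x - _]subrACA subKr.
      apply: le_trans (ler_normB _ _) _; apply: lerD; first exact/fgh/ED.
      exact: ler_normB.
  rewrite ge0_integralD//; [|by move=> x /ED; exact: h0
    |exact/measurable_EFinP| |]; last 2 first.
  - by move=> x _; rewrite adde_ge0.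
  - by apply: emeasurable_funD; exact/measurable_EFinP.
  rewrite ge0_integralD//; [|exact/measurable_EFinP|exact/measurable_EFinP].
  apply: leeD; first exact: integral_subset.
  by apply: leeD; (apply: le_trans (integral_subset ED _) _; [by []|exact: ltW]).
apply: (@le_trans _ _ ((e / 4 + e / 4)%:E +
  (\int[mu]_(x in D) (h x)%:E + ((e / 4)%:E + (e / 4)%:E)))%E).
  apply: (@le_trans _ _
    (`|(v - simple_integral D (s k)) - (w - simple_integral D (r k))|%:E +
      `|simple_integral D (s k) - simple_integral D (r k)|%:E)%E).
    by rewrite -EFinD lee_fin ler_normD.
  apply: leeD => //; rewrite lee_fin; apply: le_trans (ler_normB _ _) _.
  by apply: lerD; exact: ltW.
rewrite addeCA -!EFinD; apply: leeD => //; rewrite lee_fin; lra.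
Unshelve. all: by end_near. Qed.

Lemma bochner_unique D f v w : measurable D -> (mu D < +oo)%E ->
  is_bochner_integral D f v -> is_bochner_integral D f w -> v = w.
Proof.
move=> mD Dfin fv fw; apply/eqP; rewrite -subr_eq0 -normr_le0 -lee_fin.
have f0 x : D x -> `|f x - f x| <= 0 by rewrite subrr normr0.
have := @bochner_dist_le D f f v w (fun=> 0) mD Dfin fv fw (measurable_cst _) f0.
by rewrite integral0_eq.
Qed.

End NormedSpace.

(** Dominated convergence gives the [L^1] convergence; the simple integrals are
    then a Cauchy sequence, and the space is complete. *)
Lemma bochner_dominated (V : completeNormedModType R) (D : set R) (f : R -> V)
    (s : nat -> R -> V) (h : R -> R) :
  measurable D -> (mu D < +oo)%E -> (forall k, simple_fun (s k)) ->
  (forall x, D x -> s k x @[k --> \oo] --> f x) ->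
  (forall k x, D x -> `|s k x| <= h x) ->
  mu.-integrable D (EFin \o h) ->
  exists v, simple_integral D (s k) @[k --> \oo] --> v /\
    is_bochner_integral D f v.
Proof.
move=> mD Dfin ss sf sh ih.
have mfs k : measurable_fun D (fun x => `|f x - s k x|).
  exact: (measurable_norm_sub mD ss sf).
have fh x : D x -> `|f x| <= h x.
  move=> Dx.
  have sfn : `|s k x| @[k --> \oo] --> `|f x| by apply: cvg_norm; exact: sf.
  rewrite -(cvg_lim _ sfn)//; apply: limr_le; first by apply/cvg_ex; exists `|f x|.
  by apply: nearW => k; exact: sh.
have is0 : (\int[mu]_(x in D) `|f x - s k x|%:E)%E @[k --> \oo] --> 0%E.
  rewrite -(integral0 mu D).
  apply: (@dominated_cvg _ _ _ mu D mD _ _ (fun x => (2 : R)%:E * (h x)%:E)%E) => //.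
  - by move=> k; apply/measurable_EFinP; exact: mfs.
  - move=> x Dx; apply: cvg_EFin; first by apply: nearW.
    rewrite -[0](@normr0 _ V) -(subrr (f x)).
    by apply: cvg_norm; apply: cvgB; [exact: cvg_cst|exact: sf].
  - exact: integrableZl.
  - move=> k x Dx; rewrite gee0_abs ?lee_fin//.
    have : `|f x - s k x| <= 2 * h x.
      apply: le_trans (ler_normB _ _) _.
      by rewrite mulr2n mulrDl !mul1r lerD ?fh ?sh.
    by rewrite -lee_fin EFinM.
have : cvg (simple_integral D (s k) @[k --> \oo]).
  apply/cauchy_cvgP; apply: cauchy_exP => e e0.
  have e20 : 0 < e / 2 by rewrite divr_gt0.
  have [K _ HK] := lt_near0 e20 is0.
  exists (simple_integral D (s K)); exists K => // k /= Kk.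
  rewrite -ball_normE/= -lte_fin.
  apply: le_lt_trans (simple_integral_dist mD Dfin (ss K) (ss k)) _.
  apply: (@le_lt_trans _ _
      (\int[mu]_(x in D) (`|f x - s K x|%:E + `|f x - s k x|%:E)%E)%E).
    apply: ge0_le_integral => //.
    - apply/measurable_EFinP; apply: measurable_funTS; apply: simple_fun_norm.
      exact: simple_funB.
    - by apply: emeasurable_funD; apply/measurable_EFinP; exact: mfs.
    - move=> x Dx; rewrite -EFinD lee_fin.
      have -> : s K x - s k x = (f x - s k x) - (f x - s K x).
        by rewrite subrACA subrr sub0r opprB.
      by rewrite [leRHS]addrC ler_normB.
  rewrite ge0_integralD//; [|by apply/measurable_EFinP; exact: mfs
    |by apply/measurable_EFinP; exact: mfs].
  rewrite (_ : e%:E = (e / 2)%:E + (e / 2)%:E)%E; last first.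
    by rewrite -EFinD -splitr.
  by apply: lteD; apply: HK => //=.
move=> /cvg_ex[v sv]; exists v; split=> //; exists s; split=> //.
- move=> k; split=> // x x0; move: Dfin; apply: le_lt_trans.
  have [_ ms] := ss k.
  have mDs : measurable (D `&` s k @^-1` [set x]).
    by apply: measurableI => //; exact: ms.
  by apply: le_measure; rewrite ?inE.
- exact: aeW.
Qed.

End Bochner.

(** * The Beta integral *)

Section Beta.
Context {R : realType}.
Local Notation mu := (@lebesgue_measure R).

Lemma powR_continuous (r x : R) : 0 < x -> {for x, continuous (fun y => y `^ r)}.
Proof.
move=> x0; apply: differentiable_continuous; apply/derivable1_diffP.
by apply: derivable_powR; rewrite in_itv/= x0.
Qed.

(** The fundamental theorem of calculus on compact subintervals, followed by
    monotone convergence: the integrand may blow up at both ends. *)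
Lemma ge0_integral_le_primitive (p q B : R) (h F : R -> R) : p < q ->
  {in `]p, q[, forall x, 0 <= h x} ->
  {in `]p, q[, forall x, {for x, continuous h}} ->
  {in `]p, q[, forall x : R, is_derive (x : R^o) (1 : R^o) (F : R^o -> R^o) (h x)} ->
  {in `]p, q[ &, forall x y, F y - F x <= B} ->
  (\int[mu]_(x in `]p, q[) (h x)%:E <= B%:E)%E.
Proof.
move=> pq h0 ch dF FB.
(* A denominator above 2 leaves room for a margin on both sides. *)
pose d (i : nat) : R := (q - p) / i.+3%:R.
have d0 i : 0 < d i by rewrite divr_gt0// subr_gt0.
have d3 i : d i <= (q - p) / 3.
  by rewrite ler_pM2l ?subr_gt0// lef_pV2 ?posrE// ler_nat.
have sub i x : p + d i <= x -> x <= q - d i -> p < x < q.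
  by move=> h1 h2; move: (d0 i) => ?; apply/andP; split; lra.
pose I i : set R := `[p + d i, q - d i]%classic.
have UI : `]p, q[%classic = \bigcup_i I i.
  apply/seteqP; split=> [x|x [i _]]; last first.
    by rewrite /I/= !in_itv/= => /andP[] /sub h1 /h1.
  rewrite /= in_itv/= => /andP[px xq].
  pose e := Num.min (x - p) (q - x).
  have e0 : 0 < e by rewrite lt_min !subr_gt0 px xq.
  have [k _ Hk] : \forall k \near \oo, k.+1%:R^-1 < e / (q - p).
    by apply: near_infty_natSinv_lt (PosNum _); rewrite divr_gt0// subr_gt0.
  have dk : d k < e.
    rewrite /d mulrC -ltr_pdivlMr ?subr_gt0//; apply: le_lt_trans (Hk k (leqnn k)).
    by rewrite lef_pV2 ?posrE// ler_nat; exact/leqW/leqW.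
  move: dk; rewrite lt_min => /andP[h1 h2].
  by exists k => //; rewrite /I/= in_itv/=; apply/andP; split; lra.
have mh : measurable_fun (`]p, q[%classic : set R) (EFin \o h).
  apply/measurable_EFinP; apply: open_continuous_measurable_fun.
    exact: itv_open.
  by move=> x; rewrite inE; exact: ch.
have nd : {homo I : n m / (n <= m)%N >-> (n <= m)%O}.
  move=> n m nm; apply/subsetPset => x; rewrite /I/= !in_itv/= => /andP[h1 h2].
  have : d m <= d n by rewrite ler_pM2l ?subr_gt0// lef_pV2 ?posrE// ler_nat.
  by move=> dd; apply/andP; split; lra.
have mI i : measurable (I i) by exact: measurable_itv.
have cvgI : (\int[mu]_(x in I i) (h x)%:E)%E @[i --> \oo] -->
    (\int[mu]_(x in `]p, q[) (h x)%:E)%E.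
  rewrite UI; apply: ge0_nondecreasing_set_cvg_integral => //.
  - move=> i; apply: measurable_funS mh => //.
    by move=> x; rewrite UI => Ix; exists i.
  - move=> i x; rewrite /I/= in_itv/= => /andP[h1 h2]; rewrite lee_fin h0// in_itv/=.
    exact: sub h1 h2.
rewrite -(cvg_lim _ cvgI)//; apply: lime_le.
  by apply/cvg_ex; eexists; exact: cvgI.
apply: nearW => i.
have ab : p + d i < q - d i by move: (d3 i) => ?; lra.
have inI x : x \in `[p + d i, q - d i] -> x \in `]p, q[.
  by rewrite !in_itv/= => /andP[]; exact: sub.
have cF x : x \in `]p, q[ -> {for x, continuous F}.
  move=> xpq; apply: differentiable_continuous; apply/derivable1_diffP.
  by have [] := dF x xpq.
have end1 : p + d i \in `]p, q[ by apply: inI; rewrite in_itv/= lexx ltW.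
have end2 : q - d i \in `]p, q[ by apply: inI; rewrite in_itv/= lexx ltW.
rewrite (@continuous_FTC2 _ h F)//.
- by rewrite -EFinB lee_fin FB.
- by apply: continuous_in_subspaceT => x; rewrite inE/= => /inI; exact: ch.
- split.
  + by move=> x /subset_itv_oo_cc/inI/dF[].
  + by apply: cvg_at_right_filter; exact: cF.
  + by apply: cvg_at_left_filter; exact: cF.
- by move=> x /subset_itv_oo_cc/inI/dF ?; rewrite derive1E derive_val.
Qed.

(** The integrand of Euler's Beta function, transported to an interval. *)
Definition beta_weight (a b p q x : R) : R := (q - x) `^ (- a) * (x - p) `^ (- b).

(** Dominates Euler's Beta function at [(1 - a, 1 - b)]. *)
Definition beta_bound (a b : R) : R := 2 / (1 - a) + 2 / (1 - b).

Lemma beta_weight_ge0 a b p q x : 0 <= beta_weight a b p q x.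
Proof. by rewrite mulr_ge0// powR_ge0. Qed.

Lemma powRN_le (a x y : R) : 0 <= a -> 0 < x -> x <= y -> y `^ (- a) <= x `^ (- a).
Proof.
move=> a0 x0 xy; rewrite !powRN lef_pV2 ?posrE ?powR_gt0//; last exact: lt_le_trans xy.
by apply: ge0_ler_powR; rewrite ?nnegrE// ltW// (lt_le_trans x0).
Qed.

Lemma powRN_half (a x : R) : 0 <= a -> a <= 1 -> 0 < x ->
  (x / 2) `^ (- a) <= 2 * x `^ (- a).
Proof.
move=> a0 a1 x0; have x0' := ltW x0.
have -> : (x / 2) `^ (- a) = 2 `^ a * x `^ (- a).
  by rewrite powRM ?invr_ge0// mulrC -powR_inv1// -powRrM mulrNN mul1r.
by rewrite ler_wpM2r ?powR_ge0// ler1_powR// ler1n.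
Qed.

Lemma beta_weight_continuous a b p q x : p < x -> x < q ->
  {for x, continuous (beta_weight a b p q)}.
Proof.
move=> px xq; apply: cvgM.
  apply: (@continuous_comp _ _ _ (fun y => q - y) (fun z => z `^ (- a))).
    by apply: cvgB; [exact: cvg_cst|exact: cvg_id].
  by apply: powR_continuous; rewrite subr_gt0.
apply: (@continuous_comp _ _ _ (fun y => y - p) (fun z => z `^ (- b))).
  by apply: cvgB; [exact: cvg_id|exact: cvg_cst].
by apply: powR_continuous; rewrite subr_gt0.
Qed.

Lemma measurable_beta_weight a b p q :
  measurable_fun (`]p, q[%classic : set R) (beta_weight a b p q).
Proof.
apply: open_continuous_measurable_fun; first exact: itv_open.
by move=> x; rewrite inE/= in_itv/= => /andP[]; exact: beta_weight_continuous.
Qed.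

(** On each half of the interval one of the two factors is bounded, and the
    other one has an explicit primitive. *)
Lemma integral_beta_weight a b p q : 0 <= a -> a < 1 -> 0 <= b -> b < 1 -> p < q ->
  (\int[mu]_(x in `]p, q[) (beta_weight a b p q x)%:E <=
    (beta_bound a b * (q - p) `^ (1 - a - b))%:E)%E.
Proof.
move=> a0 a1 b0 b1 pq.
have L0 : 0 < q - p by rewrite subr_gt0.
pose ca := 2 * (q - p) `^ (- a); pose cb := 2 * (q - p) `^ (- b).
have ca0 : 0 <= ca by rewrite mulr_ge0// powR_ge0.
have cb0 : 0 <= cb by rewrite mulr_ge0// powR_ge0.
pose h x := ca * (x - p) `^ (- b) + cb * (q - x) `^ (- a).
pose F x := ca / (1 - b) * (x - p) `^ (1 - b) - cb / (1 - a) * (q - x) `^ (1 - a).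
have ch x : p < x -> x < q -> {for x, continuous h}.
  move=> px xq; apply: cvgD; apply: cvgM; try exact: cvg_cst.
    apply: (@continuous_comp _ _ _ (fun y => y - p) (fun z => z `^ (- b))).
      by apply: cvgB; [exact: cvg_id|exact: cvg_cst].
    by apply: powR_continuous; rewrite subr_gt0.
  apply: (@continuous_comp _ _ _ (fun y => q - y) (fun z => z `^ (- a))).
    by apply: cvgB; [exact: cvg_cst|exact: cvg_id].
  by apply: powR_continuous; rewrite subr_gt0.
have dF x : p < x -> x < q -> is_derive (x : R^o) (1 : R^o) (F : R^o -> R^o) (h x).
  move=> px xq.
  have x1 : 0 < x - p by rewrite subr_gt0.
  have x2 : 0 < q - x by rewrite subr_gt0.
  have d1 : is_derive (x : R^o) (1 : R^o) (fun x : R^o => (x - p) `^ (1 - b))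
      ((1 - b) * (x - p) `^ (- b)).
    have dp : is_derive (x : R^o) (1 : R^o) (fun y : R^o => y - p) (1 - 0).
      exact: is_deriveB (is_derive_id _ _) (is_derive_cst _ _ _).
    apply: is_derive_eq (@is_derive1_comp R (fun z => z `^ (1 - b))
      (fun y => y - p) x _ _ (is_derive1_powR (1 - b) x1) dp) _.
    by rewrite subr0 mulr1 [1 - b - 1]addrAC subrr sub0r.
  have d2 : is_derive (x : R^o) (1 : R^o) (fun x : R^o => (q - x) `^ (1 - a))
      (- ((1 - a) * (q - x) `^ (- a))).
    have dq : is_derive (x : R^o) (1 : R^o) (fun y : R^o => q - y) (0 - 1).
      exact: is_deriveB (is_derive_cst _ _ _) (is_derive_id _ _).
    apply: is_derive_eq (@is_derive1_comp R (fun z => z `^ (1 - a))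
      (fun y => q - y) x _ _ (is_derive1_powR (1 - a) x2) dq) _.
    by rewrite sub0r mulrN1 [1 - a - 1]addrAC subrr sub0r.
  apply: is_derive_eq (is_deriveB (is_deriveZ (ca / (1 - b)) d1)
    (is_deriveZ (cb / (1 - a)) d2)) _.
  rewrite /h /GRing.scale/= mulrN opprK.
  by congr (_ + _); field; lra.
apply: (@le_trans _ _ (\int[mu]_(x in `]p, q[) (h x)%:E)%E).
  apply: ge0_le_integral => //.
  - by move=> x _; rewrite lee_fin beta_weight_ge0.
  - by apply/measurable_EFinP; exact: measurable_beta_weight.
  - apply/measurable_EFinP; apply: open_continuous_measurable_fun.
      exact: itv_open.
    by move=> x; rewrite inE/= in_itv/= => /andP[]; exact: ch.
  - move=> x /=; rewrite in_itv/= => /andP[px xq].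
    rewrite lee_fin /beta_weight /h.
    have P1 : 0 <= (x - p) `^ (- b) by exact: powR_ge0.
    have P2 : 0 <= (q - x) `^ (- a) by exact: powR_ge0.
    have [xm|xm] := lerP ((q - p) / 2) (q - x).
      apply: (@le_trans _ _ (ca * (x - p) `^ (- b))); last first.
        by rewrite lerDl mulr_ge0.
      rewrite ler_wpM2r//; apply: le_trans (powRN_half a0 (ltW a1) L0).
      by apply: powRN_le => //; rewrite divr_gt0.
    apply: (@le_trans _ _ (cb * (q - x) `^ (- a))); last first.
      by rewrite lerDr mulr_ge0.
    rewrite mulrC ler_wpM2r//; apply: le_trans (powRN_half b0 (ltW b1) L0).
    by apply: powRN_le => //; [rewrite divr_gt0|lra].
apply: (@ge0_integral_le_primitive p q _ h F) => //.
- by move=> x _; rewrite addr_ge0// mulr_ge0// powR_ge0.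
- by move=> x; rewrite in_itv/= => /andP[]; exact: ch.
- by move=> x; rewrite in_itv/= => /andP[]; exact: dF.
- move=> x y; rewrite !in_itv/= => /andP[px xq] /andP[py yq].
  have e1 : (q - p) `^ (1 - a - b) = (q - p) `^ (- a) * (q - p) `^ (1 - b).
    by rewrite -powRD ?(gt_eqF L0) ?implybT//; congr (_ `^ _); ring.
  have e2 : (q - p) `^ (1 - a - b) = (q - p) `^ (- b) * (q - p) `^ (1 - a).
    by rewrite -powRD ?(gt_eqF L0) ?implybT//; congr (_ `^ _); ring.
  have ->: beta_bound a b * (q - p) `^ (1 - a - b) =
      ca / (1 - b) * (q - p) `^ (1 - b) + cb / (1 - a) * (q - p) `^ (1 - a).
    rewrite /beta_bound mulrDl {1}e2 e1 /ca /cb; ring.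
  have c1 : 0 <= ca / (1 - b) by rewrite divr_ge0// subr_ge0 ltW.
  have c2 : 0 <= cb / (1 - a) by rewrite divr_ge0// subr_ge0 ltW.
  have b1' : 0 <= 1 - b by lra.
  have a1' : 0 <= 1 - a by lra.
  have y1 : (y - p) `^ (1 - b) <= (q - p) `^ (1 - b).
    by apply: ge0_ler_powR; rewrite ?nnegrE//; lra.
  have x1 : (q - x) `^ (1 - a) <= (q - p) `^ (1 - a).
    by apply: ge0_ler_powR; rewrite ?nnegrE//; lra.
  have P1 : 0 <= ca / (1 - b) * (x - p) `^ (1 - b) by rewrite mulr_ge0// powR_ge0.
  have P2 : 0 <= cb / (1 - a) * (q - y) `^ (1 - a) by rewrite mulr_ge0// powR_ge0.
  have P3 : ca / (1 - b) * (y - p) `^ (1 - b) <= ca / (1 - b) * (q - p) `^ (1 - b).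
    by rewrite ler_wpM2l.
  have P4 : cb / (1 - a) * (q - x) `^ (1 - a) <= cb / (1 - a) * (q - p) `^ (1 - a).
    by rewrite ler_wpM2l.
  rewrite /F; lra.
Qed.

End Beta.

(** * Riemann sums of singular integrands *)

Section Riemann.
Context {R : realType}.
Local Notation mu := (@lebesgue_measure R).

Definition node (p q : R) (n j : nat) : R := p + (q - p) / n.+1%:R * j%:R.

(** The node [p] itself is left out, the integrands being singular there. *)
Definition riemann_sum {V : normedModType R} (f : R -> V) (p q : R) (n : nat) : V :=
  \sum_(j < n) ((q - p) / n.+1%:R) *: f (node p q n j.+1).

Definition riemann_step {V : normedModType R} (f : R -> V) (p q : R) (n : nat)
    (x : R) : V :=
  \sum_(j < n) \1_(`[node p q n j.+1, node p q n j.+2[) x *: f (node p q n j.+1).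

Definition integral_lim {V : normedModType R} (f : R -> V) (p q : R) : V :=
  lim (riemann_sum f p q n @[n --> \oo]).

(** The integrands of the variation of constants formula: the singularity at
    the right end is due to the smoothing, the one at the left end to the initial
    value. *)
Definition beta_integrand {V : normedModType R} (a b p q K : R) (f : R -> V) :=
  (forall x, p < x -> x < q -> {for x, continuous f}) /\
  (forall x, p < x -> x < q -> `|f x| <= K * beta_weight a b p q x).

Lemma simple_riemann_step (V : normedModType R) (f : R -> V) (p q : R) n :
  simple_fun (riemann_step f p q n).
Proof.
apply: (simple_fun_sum (s := fun (j : 'I_n) x =>
  \1_(`[node p q n j.+1, node p q n j.+2[) x *: f (node p q n j.+1))) => j.
by apply: simple_fun_indic; exact: measurable_itv.
Qed.

Lemma measure_oo_fin (p q : R) : (mu `]p, q[%classic < +oo)%E.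
Proof. by rewrite lebesgue_measure_itv/=; case: ifP => // _; rewrite -EFinB ltry. Qed.

Lemma simple_integral_riemann_step (V : normedModType R) (f : R -> V)
    (p' p q q' : R) n :
  p' <= p -> p < q -> q <= q' ->
  simple_integral `]p', q'[%classic (riemann_step f p q n) = riemann_sum f p q n.
Proof.
move=> pp pq qq; rewrite /riemann_step simple_integral_sum//;
  [|exact: measure_oo_fin|]; last first.
  by move=> j; apply: simple_fun_indic; exact: measurable_itv.
apply: eq_bigr => j _.
have d0 : 0 < (q - p) / n.+1%:R by rewrite divr_gt0// subr_gt0.
rewrite simple_integral_indic;
  [|exact: measurable_itv|exact: measure_oo_fin|exact: measurable_itv].
congr (_ *: _).
have lastq : (q - p) / n.+1%:R * j.+2%:R <= q - p.
  by rewrite mulrAC ler_pdivrMr// ler_wpM2l ?subr_ge0 ?(ltW pq)// ler_nat ltnS.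
have first0 : 0 < (q - p) / n.+1%:R * j.+1%:R by rewrite mulr_gt0.
have next : (q - p) / n.+1%:R * j.+2%:R =
    (q - p) / n.+1%:R * j.+1%:R + (q - p) / n.+1%:R.
  by rewrite -[j.+2]addn1 natrD mulrDr mulr1.
have -> : `]p', q'[%classic `&` `[node p q n j.+1, node p q n j.+2[%classic =
    `[node p q n j.+1, node p q n j.+2[%classic.
  apply/setIidPr => x /=; rewrite !in_itv/= /node; move: lastq first0.
  move: (_ * j.+1%:R) (_ * j.+2%:R) => A B ? ? /andP[h1 h2].
  by apply/andP; split; lra.
rewrite lebesgue_measure_itv/= lte_fin /node next addrA.
by rewrite ltrDl d0/= addrAC subrr add0r.
Qed.

(** The nearness of the sampled point [y] to [x] gives convergence, and its
    distance from the left end gives domination. *)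
Lemma riemann_stepP (V : normedModType R) (f : R -> V) (p q : R) n (x : R) :
  p < x -> x < q ->
  x < p + (q - p) / n.+1%:R /\ riemann_step f p q n x = 0 \/
  exists y, [/\ p < y, y <= x, x - (q - p) / n.+1%:R < y, (x - p) / 2 <= y - p &
    riemann_step f p q n x = f y].
Proof.
move=> px xq; set d := (q - p) / n.+1%:R.
have d0 : 0 < d by rewrite divr_gt0// subr_gt0 (lt_trans px).
have dn : d * n.+1%:R = q - p by rewrite mulfVK.
pose m := Num.truncn ((x - p) / d).
have xd0 : 0 <= (x - p) / d by rewrite divr_ge0// ?subr_ge0 ltW.
have /andP[m1 m2] := truncn_itv xd0; rewrite -/m in m1 m2.
have {}m1 : d * m%:R <= x - p by rewrite mulrC -ler_pdivlMr.
have {}m2 : x - p < d * m.+1%:R by rewrite mulrC -ltr_pdivrMr.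
have mn : (m <= n)%N.
  rewrite -ltnS -(ltr_nat R) -(ltr_pM2l d0) dn; apply: le_lt_trans m1 _; lra.
have inj j : (x \in `[node p q n j.+1, node p q n j.+2[%classic) = (j.+1 == m).
  apply/idP/eqP => [|jm].
    rewrite inE/= in_itv/= /node -/d => /andP[h1 h2].
    have h3 : d * j.+1%:R < d * m.+1%:R by lra.
    have h4 : d * m%:R < d * j.+2%:R by lra.
    move: h3 h4; rewrite !ltr_pM2l// !ltr_nat !ltnS => h3 h4.
    by apply/eqP; rewrite eqn_leq h3.
  by rewrite inE/= in_itv/= /node -/d jm; apply/andP; split; lra.
have [m0|m_gt0] := posnP m.
  left; split; first by rewrite m0 mulr1 in m2; lra.
  rewrite /riemann_step big1// => j _.
  by rewrite indicE inj m0 scale0r.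
right; exists (node p q n m); rewrite /node -/d.
have dm : d * m.+1%:R = d * m%:R + d by rewrite -addn1 natrD mulrDr mulr1.
have md : d <= d * m%:R by rewrite ler_peMr// ?ler1n// ltW.
split; [lra|lra|lra|lra|].
have jn : (m.-1 < n)%N by rewrite prednK.
rewrite /riemann_step (bigD1 (Ordinal jn))//= big1 ?addr0 => [|j jm].
  by rewrite indicE inj prednK// eqxx scale1r /node.
rewrite indicE inj (_ : (j.+1 == m) = false) ?scale0r//.
by apply: contraNF jm => /eqP jm; rewrite -val_eqE/= -jm.
Qed.

Lemma mesh_near (p q e : R) : p < q -> 0 < e ->
  \forall n \near \oo, (q - p) / n.+1%:R < e.
Proof.
move=> pq e0; have e1 : 0 < e / (q - p) by rewrite divr_gt0// subr_gt0.
have := near_infty_natSinv_lt (PosNum e1); apply: filterS => n /=.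
by rewrite ltr_pdivlMr ?subr_gt0// mulrC.
Qed.

Lemma riemann_step_cvg (V : normedModType R) (f : R -> V) (p q x : R) :
  p < x -> x < q ->
  {for x, continuous f} -> riemann_step f p q n x @[n --> \oo] --> f x.
Proof.
move=> px xq cf; apply/cvgrPdist_lt => e e0.
have /cvgrPdist_lt/(_ e e0)/nbhs_ballP[r /= r0 rf] := cf.
have xp : 0 < x - p by rewrite subr_gt0.
have m0 : 0 < Num.min r (x - p) by rewrite lt_min r0.
near=> n.
have : (q - p) / n.+1%:R < Num.min r (x - p).
  by near: n; apply: mesh_near => //; exact: lt_trans xq.
rewrite lt_min; move: (riemann_stepP f n px xq); move: ((q - p) / _) => d.
move=> stepP /andP[h1 h2].
case: stepP => [[h3 _]|[y [py yx h3 _ ->]]]; first by exfalso; lra.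
by apply: rf; rewrite /ball/= ger0_norm ?subr_ge0//; lra.
Unshelve. all: by end_near. Qed.

Lemma beta_integrand_ge0 (V : normedModType R) (a b p q K : R) (f : R -> V) : p < q ->
  beta_integrand a b p q K f -> 0 <= K.
Proof.
move=> pq [_ fK]; pose x := (p + q) / 2.
have px : p < x by rewrite /x; lra.
have xq : x < q by rewrite /x; lra.
have w0 : 0 < beta_weight a b p q x by rewrite mulr_gt0// powR_gt0// subr_gt0.
by rewrite -(pmulr_lge0 _ w0); apply: le_trans (fK _ px xq).
Qed.

Lemma integrable_beta_weight (a b p q K : R) : 0 <= a -> a < 1 -> 0 <= b -> b < 1 ->
  p < q -> 0 <= K ->
  mu.-integrable `]p, q[%classic (fun x => (K * beta_weight a b p q x)%:E).
Proof.
move=> a0 a1 b0 b1 pq K0; apply/integrableP; split.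
  apply/measurable_EFinP; apply: measurable_funM => //.
  exact: measurable_beta_weight.
under eq_integral.
  move=> x _; rewrite gee0_abs ?lee_fin; last by rewrite mulr_ge0// beta_weight_ge0.
  over.
under eq_integral do rewrite EFinM.
rewrite ge0_integralZl//; last 2 first.
- by apply/measurable_EFinP; exact: measurable_beta_weight.
- by move=> x _; rewrite lee_fin beta_weight_ge0.
apply: lte_mul_pinfty; rewrite ?lee_fin//.
exact: le_lt_trans (integral_beta_weight a0 a1 b0 b1 pq) (ltry _).
Qed.

(** Rounding down to a node keeps the weight within a factor 2 on the left of
    the interval and decreases it on the right, so the step functions are
    dominated by an integrable function. *)
Lemma riemann_sum_cvg (V : completeNormedModType R) (f : R -> V) (a b p q K : R) :
  0 <= a -> a < 1 -> 0 <= b -> b < 1 -> p < q -> beta_integrand a b p q K f ->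
  riemann_sum f p q n @[n --> \oo] --> integral_lim f p q /\
  is_bochner_integral `]p, q[%classic f (integral_lim f p q).
Proof.
move=> a0 a1 b0 b1 pq fK; have K0 := beta_integrand_ge0 pq fK.
have [cf {}fK] := fK.
have dom n x : `]p, q[%classic x ->
    `|riemann_step f p q n x| <= 2 * K * beta_weight a b p q x.
  rewrite /= in_itv/= => /andP[px xq].
  have [[_ ->]|[y [py yx _ yp ->]]] := riemann_stepP f n px xq.
    by rewrite normr0; apply: mulr_ge0; [rewrite mulr_ge0|exact: beta_weight_ge0].
  have yq : y < q by exact: le_lt_trans xq.
  apply: le_trans (fK _ py yq) _; rewrite [2 * K]mulrC -mulrA ler_wpM2l//.
  rewrite /beta_weight mulrCA; apply: ler_pM; rewrite ?powR_ge0//.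
    by apply: powRN_le => //; lra.
  apply: le_trans (powRN_half b0 (ltW b1) _); last by lra.
  by apply: powRN_le => //; lra.
have [||v [sv fv]] := @bochner_dominated R V `]p, q[%classic f (riemann_step f p q)
    (fun x => 2 * K * beta_weight a b p q x)
    (measurable_itv _) (measure_oo_fin p q) (simple_riemann_step f p q) _ dom _.
- move=> x /=; rewrite in_itv/= => /andP[px xq].
  by apply: riemann_step_cvg => //; exact: cf.
- by apply: integrable_beta_weight => //; rewrite mulr_ge0.
have {}sv : riemann_sum f p q n @[n --> \oo] --> v.
  by under eq_fun => n do rewrite -(simple_integral_riemann_step f n (lexx p) pq (lexx q)).
have -> : integral_lim f p q = v by exact: cvg_lim sv.
by split.
Qed.

(** What the two singularities leave of the length of the interval is a power of
    it, from which the time exponents of all later estimates are read off. *)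
Lemma bochner_beta_le (V : normedModType R) (f g : R -> V) v w (a b p q K : R) :
  0 <= a -> a < 1 -> 0 <= b -> b < 1 -> p < q -> 0 <= K ->
  is_bochner_integral `]p, q[%classic f v ->
  is_bochner_integral `]p, q[%classic g w ->
  (forall x, p < x -> x < q -> `|f x - g x| <= K * beta_weight a b p q x) ->
  `|v - w| <= K * (beta_bound a b * (q - p) `^ (1 - a - b)).
Proof.
move=> a0 a1 b0 b1 pq K0 fv gw fgK; rewrite -lee_fin.
apply: (@le_trans _ _ (\int[mu]_(x in `]p, q[) (K * beta_weight a b p q x)%:E)%E).
  apply: (bochner_dist_le _ _ fv gw); [exact: measurable_itv|exact: measure_oo_fin| |].
    by apply: measurable_funM => //; exact: measurable_beta_weight.
  by move=> x /=; rewrite in_itv/= => /andP[]; exact: fgK.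
under eq_integral do rewrite EFinM.
rewrite ge0_integralZl//; last 2 first.
- by apply/measurable_EFinP; exact: measurable_beta_weight.
- by move=> x _; rewrite lee_fin beta_weight_ge0.
by rewrite EFinM; apply: lee_wpmul2l; [rewrite lee_fin|exact: integral_beta_weight].
Qed.

End Riemann.

(** * Calculus of limits of Riemann sums *)

Section IntegralLim.
Context {R : realType}.
Local Notation mu := (@lebesgue_measure R).

Lemma riemann_sum_lin (V : normedModType R) (f g : R -> V) (k p q : R) n :
  riemann_sum (fun x => k *: f x + g x) p q n =
    k *: riemann_sum f p q n + riemann_sum g p q n.
Proof.
rewrite /riemann_sum scaler_sumr -big_split/=; apply: eq_bigr => j _.
by rewrite scalerDr !scalerA mulrC.
Qed.

Lemma riemann_sum_linear_map (V W : normedModType R) (A : {linear V -> W})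
    (f : R -> V) (p q : R) n :
  riemann_sum (A \o f) p q n = A (riemann_sum f p q n).
Proof. by rewrite /riemann_sum linear_sum; apply: eq_bigr => j _; rewrite linearZ. Qed.

Lemma riemann_sum_shift (V : normedModType R) (f : R -> V) (s p q : R) n :
  riemann_sum (fun x => f (s + x)) p q n = riemann_sum f (s + p) (s + q) n.
Proof.
by apply: eq_bigr => j _; rewrite /node opprD addrACA subrr add0r addrA.
Qed.

Lemma riemann_sum_scale (V : normedModType R) (f : R -> V) (t : R) n :
  riemann_sum f 0 t n = riemann_sum (fun x => t *: f (t * x)) 0 1 n.
Proof.
apply: eq_bigr => j _; rewrite /node !subr0 !add0r scalerA.
by congr (_ *: f _); [rewrite mul1r mulrC|rewrite mul1r mulrA].
Qed.

Lemma integral_lim_shift (V : normedModType R) (f : R -> V) (s p q : R) :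
  integral_lim (fun x => f (s + x)) p q = integral_lim f (s + p) (s + q).
Proof. by rewrite /integral_lim; under eq_fun do rewrite riemann_sum_shift. Qed.

Lemma integral_lim_scale (V : normedModType R) (f : R -> V) (t : R) :
  integral_lim f 0 t = integral_lim (fun x => t *: f (t * x)) 0 1.
Proof. by rewrite /integral_lim; under eq_fun do rewrite riemann_sum_scale. Qed.

Lemma node_itv (p q : R) n (j : 'I_n) : p < q -> p < node p q n j.+1 < q.
Proof.
move=> pq; have d0 : 0 < (q - p) / n.+1%:R by rewrite divr_gt0// subr_gt0.
have lastq : (q - p) / n.+1%:R * j.+1%:R < q - p.
  by rewrite mulrAC ltr_pdivrMr// ltr_pM2l ?subr_gt0// ltr_nat ltnS.
have first0 : 0 < (q - p) / n.+1%:R * j.+1%:R by rewrite mulr_gt0.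
rewrite /node; move: lastq first0; move: (_ * j.+1%:R) => A ? ?.
by apply/andP; split; lra.
Qed.

Lemma eq_riemann_sum (V : normedModType R) (f g : R -> V) (p q : R) n : p < q ->
  (forall x, p < x -> x < q -> f x = g x) ->
  riemann_sum f p q n = riemann_sum g p q n.
Proof.
move=> pq fg; apply: eq_bigr => j _; congr (_ *: _).
by have /andP[? ?] := node_itv j pq; exact: fg.
Qed.

Lemma eq_integral_lim (V : normedModType R) (f g : R -> V) (p q : R) : p < q ->
  (forall x, p < x -> x < q -> f x = g x) ->
  integral_lim f p q = integral_lim g p q.
Proof.
move=> pq fg; rewrite /integral_lim.
by under eq_fun do rewrite (eq_riemann_sum _ pq fg).
Qed.

Lemma beta_integrand_subl (V : normedModType R) (a b p m q K : R) (f : R -> V) :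
  0 <= a -> p < m -> m < q -> beta_integrand a b p q K f ->
  beta_integrand 0 b p m (K * (q - m) `^ (- a)) f.
Proof.
move=> a0 pm mq fK; have K0 := beta_integrand_ge0 (lt_trans pm mq) fK.
case: fK => cf fK; split=> x px xm; first by apply: cf => //; exact: lt_trans mq.
have xq := lt_trans xm mq; apply: le_trans (fK x px xq) _.
rewrite -mulrA ler_wpM2l// /beta_weight oppr0 powRr0 mul1r ler_wpM2r ?powR_ge0//.
by apply: powRN_le => //; rewrite ?subr_gt0// lerB// ltW.
Qed.

Lemma beta_integrand_subr (V : normedModType R) (a b p m q K : R) (f : R -> V) :
  0 <= b -> p < m -> m < q -> beta_integrand a b p q K f ->
  beta_integrand a 0 m q (K * (m - p) `^ (- b)) f.
Proof.
move=> b0 pm mq fK; have K0 := beta_integrand_ge0 (lt_trans pm mq) fK.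
case: fK => cf fK; split=> x mx xq; first by apply: cf => //; exact: lt_trans mx.
have px := lt_trans pm mx; apply: le_trans (fK x px xq) _.
rewrite -mulrA ler_wpM2l// /beta_weight oppr0 powRr0 mulr1 mulrC.
rewrite ler_wpM2r ?powR_ge0//.
by apply: powRN_le => //; rewrite ?subr_gt0// lerB// ltW.
Qed.

(** Step functions on longer and longer intervals, with finer and finer meshes. *)
Lemma continuous_strongly_measurable (V : normedModType R) (f : R -> V) :
  (forall t : R, 0 < t -> {for t, continuous f}) -> strongly_measurable `]0, +oo[ f.
Proof.
move=> cf; exists (fun k => riemann_step f 0 k.+1%:R (k * k.+2)).
  by move=> k; exact: simple_riemann_step.
apply: aeW => x /=; rewrite in_itv/= andbT => x0.
apply/cvgrPdist_lt => e e0.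
have /cvgrPdist_lt/(_ e e0)/nbhs_ballP[r /= r0 rf] := cf x x0.
have m0 : 0 < Num.min r x by rewrite lt_min r0.
(* With [(k + 1) ^ 2] pieces on an interval of length [k + 1]. *)
have mesh (k : nat) : (k.+1%:R - 0) / (k * k.+2).+1%:R = k.+1%:R^-1 :> R.
  have -> : ((k * k.+2).+1 = k.+1 * k.+1)%N by rewrite mulSn !mulnS addSn.
  by rewrite subr0 natrM invfM mulrA mulfV ?mul1r// pnatr_eq0.
near=> k.
have kx : x < k.+1%:R.
  apply: (@lt_trans _ _ k%:R); last by rewrite ltr_nat.
  by near: k; exact: nbhs_infty_gtr.
have : (k.+1%:R^-1 : R) < Num.min r x.
  by near: k; exact: (near_infty_natSinv_lt (PosNum m0)).
rewrite lt_min; move: (riemann_stepP f (k * k.+2) x0 kx); rewrite mesh add0r.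
move: (k.+1%:R^-1) => d stepP /andP[h1 h2].
case: stepP => [[h3 _]|[y [py yx h3 _ ->]]]; first by exfalso; lra.
by apply: rf; rewrite /ball/= ger0_norm ?subr_ge0//; lra.
Unshelve. all: by end_near. Qed.

Section Banach.
Context {V : completeNormedModType R} {a b : R}.
Hypotheses (a0 : 0 <= a) (a1 : a < 1) (b0 : 0 <= b) (b1 : b < 1).
Implicit Types (f g : R -> V) (p q : R).

Lemma integral_lim_cvg f p q K : p < q -> beta_integrand a b p q K f ->
  riemann_sum f p q n @[n --> \oo] --> integral_lim f p q.
Proof. by move=> pq fK; have [] := riemann_sum_cvg a0 a1 b0 b1 pq fK. Qed.

Lemma integral_lim_bochner f p q K : p < q -> beta_integrand a b p q K f ->
  is_bochner_integral `]p, q[%classic f (integral_lim f p q).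
Proof. by move=> pq fK; have [] := riemann_sum_cvg a0 a1 b0 b1 pq fK. Qed.

Lemma integral_lim_lin f g p q k K L : p < q ->
  beta_integrand a b p q K f -> beta_integrand a b p q L g ->
  integral_lim (fun x => k *: f x + g x) p q =
    k *: integral_lim f p q + integral_lim g p q.
Proof.
move=> pq fK gL; apply: cvg_lim => //.
under eq_fun do rewrite riemann_sum_lin.
apply: cvgD; last exact: integral_lim_cvg gL.
by apply: cvgZr; exact: integral_lim_cvg fK.
Qed.

Lemma integral_lim_linear_map (W : normedModType R) (A : {linear V -> W}) f p q K :
  continuous A -> p < q -> beta_integrand a b p q K f ->
  integral_lim (A \o f) p q = A (integral_lim f p q).
Proof.
move=> cA pq fK; apply: cvg_lim => //.
under eq_fun do rewrite riemann_sum_linear_map.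
by apply: continuous_cvg; [exact: cA|exact: integral_lim_cvg fK].
Qed.

Lemma integral_lim_le f p q K : p < q -> beta_integrand a b p q K f ->
  `|integral_lim f p q| <= K * (beta_bound a b * (q - p) `^ (1 - a - b)).
Proof.
move=> pq fK; have K0 := beta_integrand_ge0 pq fK.
have g0 : beta_integrand a b p q 0 (fun=> 0 : V).
  by split=> x _ _; [exact: cvg_cst|rewrite normr0 mul0r].
have [rs0 bo0] := riemann_sum_cvg a0 a1 b0 b1 pq g0.
have i0 : integral_lim (fun=> 0 : V) p q = 0.
  apply: cvg_lim => //; rewrite (_ : riemann_sum _ p q = fun=> 0); first exact: cvg_cst.
  by apply/funext => n; rewrite /riemann_sum big1// => j _; rewrite scaler0.
rewrite -[integral_lim f p q]subr0 -i0.
apply: (bochner_beta_le a0 a1 b0 b1 pq K0 (integral_lim_bochner pq fK) bo0) => x px xq.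
by rewrite subr0; case: fK => _; apply.
Qed.

(** The step functions of the two subintervals, put side by side, form another
    dominated sequence converging to the integrand, so that their integrals
    must have the same limit. *)
Lemma integral_lim_split f p m q K : p < m -> m < q -> beta_integrand a b p q K f ->
  integral_lim f p q = integral_lim f p m + integral_lim f m q.
Proof.
move=> pm mq fK; have pq := lt_trans pm mq; have K0 := beta_integrand_ge0 pq fK.
have cvgl := riemann_sum_cvg (lexx 0) ltr01 b0 b1 pm (beta_integrand_subl a0 pm mq fK).
have cvgr := riemann_sum_cvg a0 a1 (lexx 0) ltr01 mq (beta_integrand_subr b0 pm mq fK).
have fbo := integral_lim_bochner pq fK.
have [cf {}fK] := fK.
have out (p' q' : R) n x : p' < q' -> x <= p' \/ q' <= x -> riemann_step f p' q' n x = 0.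
  move=> pq' xout; rewrite /riemann_step big1// => j _.
  rewrite indicE memNset ?scale0r// /= in_itv/= => /andP[h1 h2].
  have /andP[h3 _] := node_itv j pq'.
  have h4 : node p' q' n j.+2 <= q'.
    rewrite /node -lerBrDl mulrAC ler_pdivrMr// ler_wpM2l ?subr_ge0 ?(ltW pq')//.
    by rewrite ler_nat ltnS.
  by case: xout => ?; lra.
(* The value at the common end [m] only serves pointwise convergence there. *)
pose s n x := 1 *: riemann_step f p m n x +
  (1 *: riemann_step f m q n x + \1_[set m] x *: f m).
have s1 n : simple_fun (fun x => 1 *: riemann_step f m q n x + \1_[set m] x *: f m).
  by apply: simple_fun_lin; [exact: simple_riemann_step|exact: simple_fun_indic].
have ss n : simple_fun (s n) by apply: simple_fun_lin => //; exact: simple_riemann_step.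
have mD : measurable (`]p, q[%classic : set R) by exact: measurable_itv.
have Dfin := measure_oo_fin p q.
have sval n x : [\/ x < m /\ s n x = riemann_step f p m n x,
    x = m /\ s n x = f m | m < x /\ s n x = riemann_step f m q n x].
  rewrite /s !scale1r indicE; have [xm|mx|->] := ltgtP x m.
  - apply: Or31; split=> //; rewrite (out m q n x)//; last by left; exact: ltW.
    by rewrite memNset ?scale0r ?addr0// => /= xm'; rewrite xm' ltxx in xm.
  - apply: Or33; split=> //; rewrite (out p m n x)//; last by right; exact: ltW.
    by rewrite memNset ?scale0r ?addr0 ?add0r// => /= xm'; rewrite xm' ltxx in mx.
  - apply: Or32; split=> //; rewrite (out m q n m)//; last by left.
    by rewrite (out p m n m)//; [rewrite mem_set// scale1r !add0r|right].
have [|||v [sv fv]] := @bochner_dominated R V `]p, q[%classic f s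
    (fun x => 2 * K * beta_weight a b p q x) mD Dfin ss.
- move=> x /=; rewrite in_itv/= => /andP[px xq].
  have [xm|mx|->] := ltgtP x m.
  + have -> : s ^~ x = riemann_step f p m ^~ x.
      by apply/funext => n; case: (sval n x) => -[? ?] //; exfalso; lra.
    by apply: riemann_step_cvg => //; exact: cf.
  + have -> : s ^~ x = riemann_step f m q ^~ x.
      by apply/funext => n; case: (sval n x) => -[? ?] //; exfalso; lra.
    by apply: riemann_step_cvg => //; exact: cf.
  + have -> : s ^~ m = fun=> f m; last exact: cvg_cst.
    by apply/funext => n; case: (sval n m) => -[? ?] //; exfalso; lra.
- move=> n x /=; rewrite in_itv/= => /andP[px xq].
  have dom y : p < y -> y <= x -> (x - p) / 2 <= y - p ->
      `|f y| <= 2 * K * beta_weight a b p q x.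
    move=> py yx yp; have yq : y < q by exact: le_lt_trans xq.
    apply: le_trans (fK _ py yq) _; rewrite [2 * K]mulrC -mulrA ler_wpM2l//.
    rewrite /beta_weight mulrCA; apply: ler_pM; rewrite ?powR_ge0//.
      by apply: powRN_le => //; lra.
    apply: le_trans (powRN_half b0 (ltW b1) _); last by lra.
    by apply: powRN_le => //; lra.
  have dom0 : `|0 : V| <= 2 * K * beta_weight a b p q x.
    by rewrite normr0; apply: mulr_ge0; [rewrite mulr_ge0|exact: beta_weight_ge0].
  case: (sval n x) => -[xm ->].
  + have [[_ ->//]|[y [py yx _ yp ->]]] := riemann_stepP f n px xm.
    exact: dom.
  + by rewrite xm in dom px *; apply: dom => //; lra.
  + have [[_ ->//]|[y [my yx _ ym ->]]] := riemann_stepP f n xm xq.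
    by apply: dom => //; lra.
- by apply: integrable_beta_weight => //; rewrite mulr_ge0.
rewrite (bochner_unique mD Dfin fbo fv).
apply: (cvg_unique _ sv) => //.
have -> : (fun n => simple_integral `]p, q[%classic (s n)) =
    (fun n => riemann_sum f p m n + riemann_sum f m q n).
  apply/funext => n; rewrite simple_integral_lin//; last exact: simple_riemann_step.
  rewrite simple_integral_lin//; [|exact: simple_riemann_step|exact: simple_fun_indic].
  rewrite simple_integral_indic// !scale1r.
  have -> : fine (mu (`]p, q[%classic `&` [set m])) = 0.
    rewrite (_ : mu _ = 0%E)//; apply: (@subset_measure0 _ _ _ mu _ [set m]) => //.
      by apply: measurableI.
    exact: lebesgue_measure_set1.
  rewrite scale0r addr0.
  by congr (_ + _); apply: simple_integral_riemann_step => //; exact: ltW.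
apply: cvgD; [exact: cvgl.1|exact: cvgr.1].
Qed.

(** Dominated convergence along a sequence of parameters that would violate
    continuity; all the integrands share one interval and one dominating
    weight. *)
Lemma integral_lim_continuous (F : R -> R -> V) (t0 r K : R) : 0 < r ->
  (forall t, `|t0 - t| < r -> beta_integrand a b 0 1 K (F t)) ->
  (forall x, 0 < x -> x < 1 -> {for t0, continuous (fun t => F t x)}) ->
  {for t0, continuous (fun t => integral_lim (F t) 0 1)}.
Proof.
move=> r0 FK cF; apply/cvgrPdist_lt => e e0.
have t0r : `|t0 - t0| < r by rewrite subrr normr0.
apply: contrapT => nnear.
have far (n : nat) : exists t, [/\ `|t0 - t| < r, `|t0 - t| < n.+1%:R^-1 &
    e <= `|integral_lim (F t0) 0 1 - integral_lim (F t) 0 1|].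
  apply: contrapT => nex; apply: nnear; apply/nbhs_ballP.
  exists (Num.min r n.+1%:R^-1); first by rewrite /= lt_min r0 invr_gt0 ltr0n.
  move=> t; rewrite /ball/= lt_min => /andP[h1 h2].
  by rewrite ltNge; apply/negP => h3; apply: nex; exists t.
have [u uP] := choice far.
have u0 : u n @[n --> \oo] --> t0.
  apply/cvgrPdist_lt => d d0.
  have := near_infty_natSinv_lt (PosNum d0); apply: filterS => n /=.
  by apply: lt_trans; have [] := uP n.
have mD : measurable (`]0, 1[%classic : set R) by exact: measurable_itv.
have K0 : 0 <= K := beta_integrand_ge0 ltr01 (FK _ t0r).
have mdiff n : measurable_fun (`]0, 1[%classic : set R) (fun x => `|F t0 x - F (u n) x|).
  apply: open_continuous_measurable_fun; first exact: itv_open.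
  move=> x; rewrite inE/= in_itv/= => /andP[x0 x1].
  have [c1 _] := FK _ t0r; have [ur _ _] := uP n; have [c2 _] := FK _ ur.
  by apply: cvg_norm; apply: cvgB; [exact: c1|exact: c2].
have int0 : (\int[mu]_(x in `]0%R, 1%R[) `|F t0 x - F (u n) x|%:E)%E @[n --> \oo] --> 0%E.
  rewrite -(integral0 mu `](0 : R), (1 : R)[%classic).
  apply: (@dominated_cvg _ _ _ mu _ mD _ _
    (fun x => (2 * K * beta_weight a b 0 1 x)%:E)) => //.
  - by move=> n; apply/measurable_EFinP; exact: mdiff.
  - move=> x /=; rewrite in_itv/= => /andP[x0 x1].
    apply: cvg_EFin; first by apply: nearW.
    rewrite -[0](@normr0 _ V) -(subrr (F t0 x)).
    apply: cvg_norm; apply: cvgB; first exact: cvg_cst.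
    exact: cvg_comp u0 (cF x x0 x1).
  - by apply: integrable_beta_weight => //; rewrite mulr_ge0.
  - move=> n x /=; rewrite in_itv/= => /andP[x0 x1].
    rewrite lee_fin normr_id; apply: le_trans (ler_normB _ _) _.
    rewrite -mulrA mulr2n mulrDl !mul1r.
    have [_ c1] := FK _ t0r; have [ur _ _] := uP n; have [_ c2] := FK _ ur.
    by apply: lerD; [exact: c1|exact: c2].
have [n _ Hn] := lt_near0 e0 int0.
have [ur _] := uP n; apply/negP; rewrite -ltNge -lte_fin.
apply: le_lt_trans (Hn n (leqnn n)).
apply: (bochner_dist_le mD (measure_oo_fin 0 1)
  (integral_lim_bochner ltr01 (FK _ t0r)) (integral_lim_bochner ltr01 (FK _ ur))) => //.
Qed.

End Banach.
End IntegralLim.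

(** * Operators between the spaces of a scale *)

Lemma linear_mapE {R : realType} (V W : lmodType R) (f : V -> W) : linear f ->
  exists A : {linear V -> W}, forall u, A u = f u.
Proof.
move=> lf; pose m := GRing.isLinear.Build R V W *:%R f lf.
by exists (HB.pack f m : {linear V -> W}).
Qed.

Section OperatorNorm.
Context {R : realType} {V W : normedModType R}.

Lemma opnorm_le (A : {linear V -> W}) (c : R) : (opnorm A <= c%:E)%E ->
  forall u, `|A u| <= c * `|u|.
Proof.
move=> Ac u; have [->|u0] := eqVneq u 0; first by rewrite linear0 !normr0 mulr0.
have nu0 : 0 < `|u| by rewrite normr_gt0.
have : (`|A (`|u|^-1 *: u)|%:E <= c%:E)%E.
  apply: le_trans Ac; apply: ereal_sup_ubound; exists (`|u|^-1 *: u) => //=.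
  by rewrite normrZ normfV normr_id mulVf// gt_eqF.
rewrite lee_fin linearZ normrZ normfV normr_id mulrC -ler_pdivlMr ?invr_gt0//.
by rewrite invrK.
Qed.

Lemma opnorm_ge0 (A : {linear V -> W}) (c : R) : (opnorm A <= c%:E)%E -> 0 <= c.
Proof.
move=> Ac; rewrite -lee_fin; apply: le_trans Ac.
by apply: ereal_sup_ubound; exists 0; rewrite /= ?linear0 ?normr0.
Qed.

Lemma bounded_linear_continuous (A : {linear V -> W}) (c : R) :
  (forall u, `|A u| <= c * `|u|) -> continuous A.
Proof.
move=> Ac x; apply/cvgrPdist_lt => e e0.
have c1 : 0 < Num.max c 1 by rewrite lt_max ltr01 orbT.
near=> y; rewrite -linearB; apply: le_lt_trans (Ac _) _.
apply: (@le_lt_trans _ _ (Num.max c 1 * `|x - y|)).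
  by rewrite ler_wpM2r// le_max lexx.
rewrite mulrC -ltr_pdivlMr//; near: y.
by apply: cvgr_dist_lt; [exact: cvg_id|rewrite divr_gt0].
Unshelve. all: by end_near. Qed.

End OperatorNorm.

Section ScaleOperators.
Context {R : realType} {X : banach_scale R}.
Implicit Types g : scale_index X.

(** The default value 0 is taken on the vectors outside [X g]. *)
Definition repr_in g (y : ambient X) : X g := xget 0 [set x | emb X g x = y].

Lemma repr_in_emb g (x : X g) : repr_in g (emb X g x) = x.
Proof.
apply: (@emb_inj R X g); rewrite /repr_in.
exact: (@xgetI _ 0 [set z | emb X g z = emb X g x] x).
Qed.

Lemma op_bounded_intro g g' (F : X g -> ambient X) (A : X g -> X g') (c : R) :
  linear A -> 0 <= c -> (forall u, emb X g' (A u) = F u) ->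
  (forall u, `|A u| <= c * `|u|) -> op_bounded g' F c.
Proof.
move=> lA c0 AF Ac; have [B BA] := linear_mapE lA.
exists B; split.
- by move=> u; rewrite BA AF.
- by apply: (bounded_linear_continuous (c := c)) => u; rewrite BA.
- apply: ge_ereal_sup => _ [u /= u1 <-]; rewrite lee_fin BA.
  by apply: le_trans (Ac u) _; rewrite ler_piMr.
Qed.

Context (S : op_family X).

(** The family has its values in the ambient space; the smoothing estimates
    bear on the map that it induces between two spaces of the scale. *)
Definition Sop g g' (t : R) (u : X g) : X g' := repr_in g' (S g t u).

Lemma op_boundedP g g' (t c : R) : op_bounded g' (S g t) c ->
  0 <= c /\ forall u, emb X g' (Sop g' t u) = S g t u /\ `|Sop g' t u| <= c * `|u|.
Proof.
move=> [A [AS _ Ac]]; split; first exact: opnorm_ge0 Ac.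
by move=> u; rewrite /Sop -AS repr_in_emb; split=> //; exact: opnorm_le.
Qed.

Lemma smooths_bound g g' : smooths S g g' -> forall T : R, 0 < T ->
  exists2 M : R, 0 <= M & forall (t : R) (u : X g), 0 < t -> t <= T ->
    `|Sop g' t u| <= M * t `^ (- dreg g' g) * `|u|.
Proof.
move=> [_ [M [_ MS]]] T T0.
have [c0 _] := op_boundedP (MS T T T0 (lexx T)).
exists (M T); first by rewrite -(pmulr_lge0 _ (powR_gt0 (- dreg g' g) T0)).
by move=> t u t0 tT; have [_ /(_ u)[]] := op_boundedP (MS T t t0 tT).
Qed.

Lemma SopE g g' (t : R) (u : X g) : smooths S g g' -> 0 < t ->
  emb X g' (Sop g' t u) = S g t u.
Proof.
by move=> [_ [M [_ MS]]] t0; have [_ /(_ u)[]] := op_boundedP (MS t t t0 (lexx t)).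
Qed.

Lemma Sop_linear g g' (t : R) : smooths S g g' -> 0 < t -> linear (Sop (g := g) g' t).
Proof.
move=> sm t0 k u v; apply: (@emb_inj R X g').
by rewrite linearP !SopE// op_linear ?ltW.
Qed.

Lemma SopB g g' (t : R) (u v : X g) : smooths S g g' -> 0 < t ->
  Sop g' t (u - v) = Sop (g := g) g' t u - Sop g' t v.
Proof.
move=> sm t0; have [A AE] := linear_mapE (Sop_linear sm t0).
by rewrite -!AE linearB.
Qed.

Lemma Sop_continuous g g' (u : X g) (t : R) : csmooths S g g' -> 0 < t ->
  {for t, continuous (fun s => Sop g' s u)}.
Proof.
move=> [sm cS] t0; have [f [fS]] := cS u.
rewrite continuous_open_subspace; last exact: rray_open.
move=> /(_ t); rewrite inE/= in_itv/= t0 => /(_ isT) cf.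
have fE s : 0 < s -> f s = Sop g' s u.
  by move=> s0; apply: (@emb_inj R X g'); rewrite fS// SopE.
rewrite /prop_for /continuous_at -fE//.
apply: cvg_trans cf; apply: near_eq_cvg; near=> s; rewrite fE//.
by near: s; exact: lt_nbhsr.
Unshelve. all: by end_near. Qed.

(** The smoothing bound is uniform for times bounded away from zero, which
    turns strong continuity into joint continuity. *)
Lemma Sop_joint_continuous g g' (p : R -> R) (w : R -> X g) (x : R) :
  csmooths S g g' -> 0 < p x -> {for x, continuous p} -> {for x, continuous w} ->
  {for x, continuous (fun y => Sop g' (p y) (w y))}.
Proof.
move=> cs p0 cp cw; have [sm _] := cs; have [d0 _] := sm.
have T0 : 0 < 2 * p x by rewrite mulr_gt0.
have [M M0 MS] := smooths_bound sm T0.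
pose C := M * (p x / 2) `^ (- dreg g' g) + 1.
have C0 : 0 < C by rewrite ltr_wpDl// mulr_ge0// powR_ge0.
apply/cvgrPdist_lt => e e0.
have e20 : 0 < e / 2 by rewrite divr_gt0.
near=> y.
have h1 : p x / 2 < p y.
  near: y; apply: (cvgr_gt (p x)); [exact: cp|lra].
have h2 : p y < 2 * p x.
  near: y; apply: (cvgr_lt (p x)); [exact: cp|lra].
have py0 : 0 < p y by apply: lt_trans h1; rewrite divr_gt0.
have h3 : `|Sop g' (p x) (w x) - Sop g' (p y) (w x)| < e / 2.
  near: y; apply: (cvgr_dist_lt (fun y => Sop g' (p y) (w x))) => //.
  by apply: (@continuous_comp _ _ _ p (fun s => Sop g' s (w x)));
    [exact: cp|exact: Sop_continuous].
have h4 : `|w x - w y| < e / 2 / C.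
  near: y; apply: cvgr_dist_lt; [exact: cw|by rewrite divr_gt0].
have -> : Sop g' (p x) (w x) - Sop g' (p y) (w y) =
    (Sop g' (p x) (w x) - Sop g' (p y) (w x)) + Sop g' (p y) (w x - w y).
  by rewrite SopB// addrA subrK.
apply: le_lt_trans (ler_normD _ _) _; rewrite [e]splitr; apply: ltrD => //.
apply: le_lt_trans (MS _ _ py0 (ltW h2)) _.
apply: (@le_lt_trans _ _ (C * `|w x - w y|)).
  rewrite ler_wpM2r// /C ler_wpDr// ler_wpM2l//.
  by apply: powRN_le => //; [rewrite divr_gt0|exact: ltW].
by rewrite mulrC -ltr_pdivlMr.
Unshelve. all: by end_near. Qed.

Hypothesis hS : semigroup_in_scale S.

(** The semigroup law holds in each single space; consistency lets the second
    factor act in any space that contains the intermediate value. *)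
Lemma S_add g g' (t s : R) (u : X g) (v : X g') : 0 <= t -> 0 <= s ->
  emb X g' v = S g s u -> S g (t + s) u = S g' t v.
Proof.
move=> t0 s0 vS; have [[A [_ AS _ AD]] _] := hS g.
rewrite -AS ?addr_ge0// AD// AS//; apply: op_consistent => //.
by rewrite AS// vS.
Qed.

Lemma Sop_add g g' g'' (t s : R) (u : X g) : smooths S g g' -> 0 < t -> 0 < s ->
  Sop g'' (t + s) u = Sop g'' t (Sop g' s u).
Proof.
by move=> sm t0 s0; rewrite /Sop (S_add (v := Sop g' s u)) ?ltW// SopE.
Qed.

End ScaleOperators.

(** * The variation of constants integral *)

(** Exchanges exponential decay for an integrable singularity. *)
Lemma expRN_le_powR {R : realType} (x theta : R) : 0 < x -> 0 <= theta -> theta <= 1 ->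
  expR (- x) <= x `^ (- theta).
Proof.
move=> x0 t0 t1; rewrite expRN powRN lef_pV2 ?posrE ?expR_gt0 ?powR_gt0//.
have [x1|x1] := lerP 1 x.
  apply: le_trans (ler1_powR x1 t1) _.
  by apply: le_trans (expR_ge1Dx x); rewrite lerDr.
apply: (@le_trans _ _ 1); last by rewrite -expR0 ler_expR ltW.
have E1 : (1 : R) `^ theta = 1 by rewrite powR1.
by rewrite -[leRHS]E1 ge0_ler_powR ?nnegrE// ltW.
Qed.

Section Duhamel.
Context {R : realType} {X : banach_scale R} {S : op_family X}.
Context {alpha : scale_index X} {rho : R} {n : nat} {beta : 'I_n -> scale_index X}.
Context {P : forall i, {linear X alpha -> X (beta i)}}.
Hypotheses (hrho : 0 <= rho) (hP : forall i, pert_class S alpha (beta i) rho (P i)).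
Context {eps : R}.
Hypotheses (eps0 : 0 <= eps) (eps1 : eps < 1).

Implicit Types (g : scale_index X) (i : 'I_n) (u v : R -> X alpha).

Definition kernel g i (t : R) u (tau : R) : X g := Sop S g (t - tau) (P i (u tau)).

(** The integral term of the variation of constants formula, as a limit of
    Riemann sums in the topology of [X g]. *)
Definition duhamel g i u (t : R) : X g := integral_lim (kernel g i t u) 0 t.

(** The continuous members of the solution class, on which Riemann sums can be
    used in place of Bochner's definition. *)
Definition admissible u :=
  (forall t : R, 0 < t -> {for t, continuous u}) /\
  forall T : R, 0 < T -> exists K : R, forall t, 0 < t -> t <= T ->
    `|u t| <= K * t `^ (- eps).

Lemma R_setsP g i : R_sets S beta g ->
  [/\ csmooths S (beta i) g, 0 <= dreg g (beta i) & dreg g (beta i) < 1].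
Proof.
move=> /(_ i I)[]; rewrite in_itv/= => /andP[h1 h2] cs; split=> //.
  by rewrite subr_ge0.
by rewrite ltrBlDl.
Qed.

Lemma R_sets_alpha : R_sets S beta alpha.
Proof.
move=> i _; have [/andP[d0 d1] cs _ _] := hP i; split=> //.
by move: d0 d1; rewrite in_itv/= /dreg => ? ?; apply/andP; split; lra.
Qed.

Lemma pert_le i x : `|P i x| <= rho * `|x|.
Proof. by have [_ _ _] := hP i; move/opnorm_le; apply. Qed.

Lemma kernel_le g i (T : R) : R_sets S beta g -> 0 < T ->
  exists2 M : R, 0 <= M & forall (t tau : R) (x : X alpha),
    0 < tau -> tau < t -> t <= T ->
    `|Sop S g (t - tau) (P i x)| <= M * (t - tau) `^ (- dreg g (beta i)) * `|x|.
Proof.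
move=> /(R_setsP i)[[sm _] _ _] T0; have [M M0 MS] := smooths_bound sm T0.
exists (M * rho); first exact: mulr_ge0.
move=> t tau x tau0 taut tT.
apply: le_trans (MS _ _ _ _) _; [by rewrite subr_gt0|lra|].
rewrite [leRHS](_ : _ = M * (t - tau) `^ (- dreg g (beta i)) * (rho * `|x|)); last by ring.
by rewrite ler_wpM2l ?pert_le// mulr_ge0// powR_ge0.
Qed.

Lemma kernel_continuous g i (t tau : R) u : R_sets S beta g -> tau < t ->
  {for tau, continuous u} -> {for tau, continuous (kernel g i t u)}.
Proof.
move=> /(R_setsP i)[cs _ _] taut cu.
apply: (Sop_joint_continuous (p := fun s => t - s) (w := fun s => P i (u s)) cs).
- by rewrite subr_gt0.
- by apply: cvgB; [exact: cvg_cst|exact: cvg_id].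
- apply: (@continuous_comp _ _ _ u (P i)) => //.
  by have [_ _ cP _] := hP i; exact: cP.
Qed.

Lemma kernel_integrand g i (T : R) : R_sets S beta g -> 0 < T ->
  exists2 M : R, 0 <= M & forall u (K t : R), 0 < t -> t <= T ->
    (forall tau, 0 < tau -> tau < t -> {for tau, continuous u}) ->
    (forall tau, 0 < tau -> tau < t -> `|u tau| <= K * tau `^ (- eps)) ->
    beta_integrand (dreg g (beta i)) eps 0 t (M * K) (kernel g i t u).
Proof.
move=> Rg T0; have [M M0 MS] := kernel_le i Rg T0; exists M => // u K t t0 tT cu uK.
split=> tau tau0 taut; first by apply: kernel_continuous => //; exact: cu.
apply: le_trans (MS _ _ _ tau0 taut tT) _.
rewrite /beta_weight subr0 [leRHS](_ : _ =
  M * (t - tau) `^ (- dreg g (beta i)) * (K * tau `^ (- eps))); last by ring.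
by rewrite ler_wpM2l ?uK// mulr_ge0// powR_ge0.
Qed.

Lemma admissible_integrand g i u (t : R) : R_sets S beta g -> admissible u -> 0 < t ->
  exists K, beta_integrand (dreg g (beta i)) eps 0 t K (kernel g i t u).
Proof.
move=> Rg [cu uK] t0; have [M _ MS] := kernel_integrand i Rg t0.
have [K Kt] := uK t t0; exists (M * K); apply: MS => // tau tau0 taut; first exact: cu.
by apply: Kt => //; exact: ltW.
Qed.

Lemma duhamel_bochner g i u (t : R) : R_sets S beta g -> admissible u -> 0 < t ->
  is_bochner_integral `]0, t[%classic (kernel g i t u) (duhamel g i u t).
Proof.
move=> Rg au t0; have [_ d0 d1] := R_setsP i Rg.
have [K HK] := admissible_integrand i Rg au t0.
exact: integral_lim_bochner HK.
Qed.

Lemma admissible_lin (k : R) u v : admissible u -> admissible v ->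
  admissible (fun t => k *: u t + v t).
Proof.
move=> [cu uK] [cv vK]; split=> [t t0|T T0].
  by apply: cvgD; [apply: cvgZr; exact: cu|exact: cv].
have [K HK] := uK T T0; have [L HL] := vK T T0; exists (`|k| * K + L) => t t0 tT.
apply: le_trans (ler_normD _ _) _; rewrite mulrDl lerD ?HL// normrZ -mulrA.
by rewrite ler_wpM2l ?HK.
Qed.

Lemma duhamel_lin g i (k : R) u v (t : R) : R_sets S beta g ->
  admissible u -> admissible v -> 0 < t ->
  duhamel g i (fun s => k *: u s + v s) t = k *: duhamel g i u t + duhamel g i v t.
Proof.
move=> Rg au av t0; have [[sm _] d0 d1] := R_setsP i Rg.
have [K HK] := admissible_integrand i Rg au t0.
have [L HL] := admissible_integrand i Rg av t0.
rewrite -(integral_lim_lin d0 d1 eps0 eps1 k t0 HK HL).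
apply: eq_integral_lim => // tau tau0 taut; rewrite /kernel linearP.
by rewrite Sop_linear// subr_gt0.
Qed.

(** The Riemann sums of the two kernels are the same ambient vectors, so the
    topological consistency of the scale identifies their limits. *)
Lemma duhamel_consistent g i u (t : R) : R_sets S beta g -> admissible u -> 0 < t ->
  emb X g (duhamel g i u t) = emb X alpha (duhamel alpha i u t).
Proof.
move=> Rg au t0; have Ra := R_sets_alpha.
have [[smg _] d0 d1] := R_setsP i Rg; have [[sma _] e0 e1] := R_setsP i Ra.
have [K HK] := admissible_integrand i Rg au t0.
have [L HL] := admissible_integrand i Ra au t0.
apply: (@emb_consistent R X g alpha (riemann_sum (kernel g i t u) 0 t)
    (riemann_sum (kernel alpha i t u) 0 t)).
- move=> k; rewrite /riemann_sum !linear_sum; apply: eq_bigr => j _.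
  rewrite !linearZ/=; congr (_ *: _).
  have /andP[? ?] := node_itv j t0.
  by rewrite /kernel !SopE// subr_gt0.
- exact: integral_lim_cvg HK.
- exact: integral_lim_cvg HL.
Qed.

(** Rescaling the time interval to [`]0, 1[] moves the dependence on [t] from the
    domain into the integrand. *)
Lemma duhamel_continuous g i u (t0 : R) : R_sets S beta g -> admissible u -> 0 < t0 ->
  {for t0, continuous (duhamel g i u)}.
Proof.
move=> Rg au t00; have [cs d0 d1] := R_setsP i Rg; have [cu uK] := au.
have T0 : 0 < 2 * t0 by rewrite mulr_gt0.
have [M M0 MS] := kernel_le i Rg T0.
have [K HK] := uK _ T0.
have K0 : 0 <= K.
  rewrite -(pmulr_lge0 _ (powR_gt0 (- eps) t00)).
  by apply: le_trans (HK t0 t00 _); [exact: normr_ge0|lra].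
set d := dreg g (beta i) in d0 d1 MS.
pose F t x := t *: kernel g i t u (t * x).
have -> : duhamel g i u = (fun t => integral_lim (F t) 0 1).
  by apply/funext => t; rewrite /duhamel integral_lim_scale.
pose h := t0 / 2; have h0 : 0 < h by rewrite divr_gt0.
apply: (@integral_lim_continuous R (X g) d eps d0 d1 eps0 eps1 F t0 h
    (2 * t0 * (M * h `^ (- d) * (K * h `^ (- eps))))) => //.
- move=> t; rewrite ltr_norml => /andP[th1 th2].
  have ht : h < t by rewrite /h in th1 th2 *; lra.
  have tT : t <= 2 * t0 by rewrite /h in th1 th2 *; lra.
  have t_gt0 : 0 < t by exact: lt_trans ht.
  split=> x x0 x1.
    apply: cvgZr; apply: (@continuous_comp _ _ _ (fun x => t * x) (kernel g i t u)).
      by apply: cvgM; [exact: cvg_cst|exact: cvg_id].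
    apply: kernel_continuous => //; first by rewrite gtr_pMr.
    by apply: cu; rewrite mulr_gt0.
  have tx0 : 0 < t * x by rewrite mulr_gt0.
  have txt : t * x < t by rewrite gtr_pMr.
  rewrite /F /kernel normrZ gtr0_norm// -[_ * _ * beta_weight _ _ _ _ _]mulrA.
  apply: ler_pM => //; first exact: ltW.
  apply: le_trans (MS _ _ _ tx0 txt tT) _.
  have -> : t - t * x = t * (1 - x) by rewrite mulrBr mulr1.
  have x10 : 0 <= 1 - x by rewrite subr_ge0 ltW.
  rewrite powRM ?(ltW t_gt0)//.
  rewrite /beta_weight subr0 mulrACA.
  apply: ler_pM => //.
  + by rewrite mulr_ge0// mulr_ge0// powR_ge0.
  + rewrite mulrA ler_wpM2r ?powR_ge0// ler_wpM2l//.
    by apply: powRN_le => //; exact: ltW.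
  + apply: le_trans (HK _ tx0 _) _; first by apply: le_trans tT; exact: ltW.
    rewrite powRM ?(ltW t_gt0) ?(ltW x0)// mulrA ler_wpM2r ?powR_ge0// ler_wpM2l//.
    by apply: powRN_le => //; exact: ltW.
- move=> x x0 x1; apply: cvgZ; first exact: cvg_id.
  apply: (Sop_joint_continuous (p := fun s => s - s * x) (w := fun s => P i (u (s * x))) cs).
  + by rewrite subr_gt0 gtr_pMr.
  + apply: cvgB; first exact: cvg_id.
    by apply: cvgM; [exact: cvg_id|exact: cvg_cst].
  + apply: (@continuous_comp _ _ _ (fun s : R => u (s * x)) (P i)); last first.
      by have [_ _ cP _] := hP i; exact: cP.
    apply: (@continuous_comp _ _ _ (fun s : R => s * x) u).
      by apply: cvgM; [exact: cvg_id|exact: cvg_cst].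
    by apply: cu; rewrite mulr_gt0.
Qed.

(** Measured against [expR (lambda * t)] the kernel gains a factor
    [expR (- lambda * (t - tau))], hence [lambda `^ (- theta)] at the price of a
    slightly worse singularity. For [lambda] large this outweighs all the
    constants, including the number [n] of perturbations. *)
Lemma duhamel_contraction (T : R) : (0 < n)%N -> 0 < T ->
  exists2 lambda : R, 0 <= lambda &
    forall i (t K : R) u v f h w z, 0 < t -> t <= T -> 0 <= K ->
    is_bochner_integral `]0, t[%classic f w -> is_bochner_integral `]0, t[%classic h z ->
    (forall tau, 0 < tau -> tau < t -> f tau = kernel alpha i t u tau) ->
    (forall tau, 0 < tau -> tau < t -> h tau = kernel alpha i t v tau) ->
    (forall tau, 0 < tau -> tau < t ->
      `|u tau - v tau| <= K * tau `^ (- eps) * expR (lambda * tau)) ->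
    `|w - z| <= K / (2 * n%:R) * t `^ (- eps) * expR (lambda * t).
Proof.
move=> n0 T0; have Ra := R_sets_alpha.
pose a i := dreg alpha (beta i).
(* Half of what is left below the critical exponent 1, so that
   [a i + theta i] is still subcritical. *)
pose theta i := (1 - a i) / 2.
have aP i : 0 <= a i /\ a i < 1 by have [_ ? ?] := R_setsP i Ra.
have thP i : [/\ 0 < theta i, theta i <= 1 & a i + theta i < 1].
  by have [? ?] := aP i; rewrite /theta; split; lra.
have [M MP] := choice (fun i => let: ex_intro2 M M0 MS := kernel_le i Ra T0 in
  ex_intro (fun M => 0 <= M /\ _) M (conj M0 MS)).
pose Q i := M i * beta_bound (a i + theta i) eps * T `^ theta i * (2 * n%:R) + 1.
have bb0 i : 0 <= beta_bound (a i + theta i) eps.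
  have [? ? ?] := thP i.
  by rewrite /beta_bound addr_ge0// divr_ge0// subr_ge0 ltW.
have Q1 i : 1 <= Q i.
  have [M0 _] := MP i.
  by rewrite lerDr mulr_ge0// mulr_ge0 ?powR_ge0// mulr_ge0.
(* The solution of [lambda `^ theta i = Q i]; the sum of these numbers works for
   all [i] at once. *)
pose l i := Q i `^ (theta i)^-1.
have l0 i : 0 < l i by rewrite powR_gt0// (lt_le_trans ltr01).
exists (\sum_i l i); first by rewrite sumr_ge0// => i _; exact: ltW.
set lambda := \sum_i l i.
move=> i t K u v f h w z t0 tT K0 fw hz fE hE uvK.
have [M0 MS] := MP i; have [th0 th1 ath] := thP i; have [ai0 ai1] := aP i.
have ll : l i <= lambda.
  by rewrite /lambda (bigD1 i)//= lerDl sumr_ge0// => j _; exact: ltW.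
have lam0 : 0 < lambda by exact: lt_le_trans ll.
have lamQ : Q i <= lambda `^ theta i.
  apply: (@le_trans _ _ (l i `^ theta i)).
    by rewrite /l -powRrM mulVf ?gt_eqF// powRr1// (le_trans ler01).
  by apply: ge0_ler_powR; rewrite ?nnegrE// ltW.
have ath0 : 0 <= a i + theta i by rewrite addr_ge0// ltW.
pose C := M i * K * expR (lambda * t) * lambda `^ (- theta i).
have C0 : 0 <= C by rewrite !mulr_ge0 ?powR_ge0 ?expR_ge0.
have := bochner_beta_le ath0 ath eps0 eps1 t0 C0 fw hz.
have bd tau : 0 < tau -> tau < t ->
    `|f tau - h tau| <= C * beta_weight (a i + theta i) eps 0 t tau.
  move=> tau0 taut; have ttau : 0 < t - tau by rewrite subr_gt0.
  rewrite fE// hE// /kernel -SopB//; last by have [[] ] := R_setsP i Ra.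
  rewrite -linearB; apply: le_trans (MS _ _ _ tau0 taut tT) _.
  apply: (@le_trans _ _ (M i * (t - tau) `^ (- a i) *
      (K * tau `^ (- eps) * expR (lambda * tau)))).
    by apply: ler_wpM2l; [rewrite mulr_ge0// powR_ge0|exact: uvK].
  have : expR (lambda * tau) <=
      expR (lambda * t) * (lambda `^ (- theta i) * (t - tau) `^ (- theta i)).
    have -> : lambda * tau = lambda * t + - (lambda * (t - tau)) by ring.
    rewrite expRD ler_wpM2l ?expR_ge0// -powRM ?(ltW lam0) ?(ltW ttau)//.
    by apply: expRN_le_powR => //; [rewrite mulr_gt0|exact: ltW].
  have -> : beta_weight (a i + theta i) eps 0 t tau =
      (t - tau) `^ (- a i) * (t - tau) `^ (- theta i) * tau `^ (- eps).
    rewrite /beta_weight subr0 -powRD ?(gt_eqF ttau) ?implybT//.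
    by rewrite opprD.
  move=> ex; rewrite /C.
  apply: (@le_trans _ _ (M i * (t - tau) `^ (- a i) * (K * tau `^ (- eps) *
    (expR (lambda * t) * (lambda `^ (- theta i) * (t - tau) `^ (- theta i)))))).
    by rewrite ler_wpM2l ?mulr_ge0 ?powR_ge0// ler_wpM2l// mulr_ge0// powR_ge0.
  by rewrite le_eqVlt; apply/orP; left; apply/eqP; ring.
move=> /(_ bd) H; apply: le_trans H _.
have -> : (t - 0) `^ (1 - (a i + theta i) - eps) = t `^ theta i * t `^ (- eps).
  rewrite subr0 -powRD ?(gt_eqF t0) ?implybT//.
  by congr (_ `^ _); rewrite /theta; field.
have tTh : t `^ theta i <= T `^ theta i.
  by apply: ge0_ler_powR; rewrite ?nnegrE// ltW.
have n2 : 0 < 2 * n%:R :> R by rewrite mulr_gt0// ltr0n.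
have main : M i * lambda `^ (- theta i) * beta_bound (a i + theta i) eps * t `^ theta i
    <= (2 * n%:R)^-1.
  rewrite -[leRHS]mul1r ler_pdivlMr//.
  apply: (@le_trans _ _ (lambda `^ (- theta i) * Q i)).
    apply: (@le_trans _ _ (lambda `^ (- theta i) *
       (M i * beta_bound (a i + theta i) eps * T `^ theta i * (2 * n%:R)))).
      rewrite [leRHS](_ : _ = M i * lambda `^ (- theta i) *
        beta_bound (a i + theta i) eps * T `^ theta i * (2 * n%:R)); last by ring.
      rewrite ler_wpM2r ?(ltW n2)// ler_wpM2l// !mulr_ge0// powR_ge0//.
    by rewrite ler_wpM2l ?powR_ge0// /Q lerDl.
  by rewrite powRN mulrC ler_pdivrMr ?powR_gt0// mul1r.
rewrite /C [leLHS](_ : _ = K * t `^ (- eps) * expR (lambda * t) *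
  (M i * lambda `^ (- theta i) * beta_bound (a i + theta i) eps * t `^ theta i)); last by ring.
rewrite [leRHS](_ : _ = K * t `^ (- eps) * expR (lambda * t) * (2 * n%:R)^-1); last by ring.
by rewrite ler_wpM2l// !mulr_ge0 ?powR_ge0 ?expR_ge0.
Qed.

End Duhamel.

(** * The mild solution *)

Lemma cvg_sum_ord {R : realType} (V : normedModType R) (T : Type)
    (F : set_system T) {FF : Filter F} (n : nat) (f : 'I_n -> T -> V) (l : 'I_n -> V) :
  (forall i, f i x @[x --> F] --> l i) ->
  \sum_i f i x @[x --> F] --> \sum_i l i.
Proof.
elim: n f l => [|n IH] f l fl.
  rewrite big_ord0 (_ : (fun x => _) = fun=> 0); first exact: cvg_cst.
  by apply/funext => s; rewrite big_ord0.
rewrite big_ord_recl.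
rewrite (_ : (fun x => _) = fun x => f ord0 x + \sum_i f (lift ord0 i) x).
  by apply: cvgD; [exact: fl|exact: (IH (fun i => f (lift ord0 i)))].
by apply/funext => s; rewrite big_ord_recl.
Qed.

Lemma halving_le0 {R : realType} (x B : R) : (forall k, x <= B * 2^-1 ^+ k) -> x <= 0.
Proof.
move=> xB.
have c : B * 2^-1 ^+ k @[k --> \oo] --> B * 0.
  apply: cvgM; first exact: cvg_cst.
  by apply: cvg_expr; rewrite ger0_norm ?invr_ge0// invf_lt1// ltr1n.
rewrite mulr0 in c; rewrite -(cvg_lim _ c)//.
by apply: limr_ge; [apply/cvg_ex; exists 0|apply: nearW].
Qed.

Section MildSolution.
Context {R : realType} {X : banach_scale R} {S : op_family X}.
Context {alpha : scale_index X} {rho : R} {n : nat} {beta : 'I_n -> scale_index X}.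
Context {P : forall i, {linear X alpha -> X (beta i)}}.
Hypotheses (hrho : 0 <= rho) (hn : (0 < n)%N).
Hypothesis hP : forall i, pert_class S alpha (beta i) rho (P i).
Context {g : scale_index X}.
Hypothesis hg : E_set S alpha g.

Local Notation eps := (dreg alpha g).
Local Notation kernel := (@kernel R X S alpha n beta P).
Local Notation duhamel := (@duhamel R X S alpha n beta P).
Local Notation admissible := (@admissible R X alpha eps).
Implicit Types (u v : R -> X alpha).

Let eps0 : 0 <= eps.
Proof. by have [] := hg; rewrite in_itv/= => /andP[_]; rewrite subr_ge0. Qed.

Let eps1 : eps < 1.
Proof. by have [] := hg; rewrite in_itv/= => /andP[? _] _; rewrite /dreg; lra. Qed.

Let hga : csmooths S g alpha.
Proof. by have [] := hg. Qed.

Let Ra : R_sets S beta alpha := R_sets_alpha hP.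

Definition locally_bounded u := forall T : R, 0 < T -> exists K : R,
  forall t, 0 < t -> t <= T -> `|u t| <= K * t `^ (- eps).

(** [y] is the sum of the integral terms at time [t], the integrals being taken
    in the sense of Bochner along some representatives of the kernels. *)
Definition integral_terms u (t : R) (y : X alpha) :=
  exists (w : 'I_n -> X alpha) (f : 'I_n -> R -> X alpha),
    [/\ forall i, is_bochner_integral `]0, t[%classic (f i) (w i),
        forall i tau, 0 < tau -> tau < t -> f i tau = kernel alpha i t u tau &
        y = \sum_i w i].

(** In the norm with weight [t `^ eps * expR (- lambda * t)] on [`]0, T]], the
    integral terms are a contraction with factor one half. *)
Definition halves (T lambda : R) := forall (t K : R) u v y z,
  0 < t -> t <= T -> 0 <= K -> integral_terms u t y -> integral_terms v t z ->
  (forall tau, 0 < tau -> tau < t ->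
    `|u tau - v tau| <= K * tau `^ (- eps) * expR (lambda * tau)) ->
  `|y - z| <= K * 2^-1 * t `^ (- eps) * expR (lambda * t).

Lemma halvesP (T : R) : 0 < T -> exists2 lambda : R, 0 <= lambda & halves T lambda.
Proof.
move=> T0; have [lambda l0 lP] := duhamel_contraction hrho hP eps0 eps1 hn T0.
exists lambda => // t K u v _ _ t0 tT K0 [w [f [fw fE ->]]] [z [h [hz hE ->]]] uv.
rewrite -sumrB; apply: le_trans (ler_norm_sum _ _ _) _.
apply: (@le_trans _ _ (\sum_(i < n) (K / (2 * n%:R) * t `^ (- eps) * expR (lambda * t)))).
  by apply: ler_sum => i _; exact:
    (lP i t K u v (f i) (h i) (w i) (z i) t0 tT K0 (fw i) (hz i) (fE i) (hE i) uv).
rewrite sumr_const card_ord -mulr_natl le_eqVlt; apply/orP; left; apply/eqP.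
by field; rewrite pnatr_eq0 -lt0n.
Qed.

Lemma duhamel_terms u (t : R) : admissible u -> 0 < t ->
  integral_terms u t (\sum_i duhamel alpha i u t).
Proof.
move=> au t0; exists (fun i => duhamel alpha i u t), (fun i => kernel alpha i t u).
by split=> // i; exact: (duhamel_bochner hrho hP eps0 eps1 i Ra au t0).
Qed.

Lemma admissible0 : admissible (fun=> 0).
Proof.
split=> [t _|T _]; first exact: cvg_cst.
by exists 0 => t _ _; rewrite normr0 mul0r.
Qed.

Lemma duhamel0 gt i (t : R) : R_sets S beta gt -> 0 < t ->
  duhamel gt i (fun=> 0) t = 0.
Proof.
move=> Rg t0; have := duhamel_lin hrho hP eps0 eps1 i 1 Rg admissible0 admissible0 t0.
rewrite (_ : (fun=> _) = fun=> 0); last by apply/funext => s; rewrite scaler0 addr0.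
by move=> /eqP; rewrite scale1r -subr_eq subrr eq_sym => /eqP.
Qed.

Lemma terms_norm (T lambda : R) : halves T lambda -> forall (t K : R) u,
  0 < t -> t <= T -> 0 <= K -> admissible u ->
  (forall tau, 0 < tau -> tau < t ->
    `|u tau| <= K * tau `^ (- eps) * expR (lambda * tau)) ->
  `|\sum_i duhamel alpha i u t| <= K * 2^-1 * t `^ (- eps) * expR (lambda * t).
Proof.
move=> hT t K u t0 tT K0 au uK; rewrite -[X in `|X|]subr0.
have z0 : \sum_i duhamel alpha i (fun=> 0) t = 0.
  by rewrite big1// => i _; exact: duhamel0.
rewrite -[X in `|_ - X|]z0.
apply: (hT t K u (fun=> 0)) => //; [exact: duhamel_terms|exact/duhamel_terms/t0/admissible0|].
by move=> tau tau0 taut; rewrite subr0 uK.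
Qed.

Lemma admissible_terms u : admissible u ->
  admissible (fun t => \sum_i duhamel alpha i u t).
Proof.
move=> au; split=> [t t0|T T0].
  apply: (cvg_sum_ord (f := fun i => duhamel alpha i u)) => i.
  exact: (duhamel_continuous hrho hP eps0 eps1 Ra au t0).
have [lambda l0 hT] := halvesP T0; have [_ /(_ T T0)[K HK]] := au.
(* The contraction estimate wants a nonnegative bound. *)
pose K' := Num.max K 0.
have K'0 : 0 <= K' by rewrite le_max lexx orbT.
exists (K' * 2^-1 * expR (lambda * T)) => t t_gt0 tT.
apply: (@le_trans _ _ (K' * 2^-1 * t `^ (- eps) * expR (lambda * t))).
  apply: (terms_norm hT) => // tau tau0 taut.
  apply: (@le_trans _ _ (K' * tau `^ (- eps))).
    apply: le_trans (HK tau tau0 _) _; first by apply: le_trans tT; exact: ltW.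
    by rewrite ler_wpM2r ?powR_ge0// le_max lexx.
  by rewrite ler_peMr ?mulr_ge0 ?powR_ge0// -expR0 ler_expR mulr_ge0// ltW.
rewrite [leRHS]mulrAC ler_wpM2l ?mulr_ge0 ?powR_ge0 ?invr_ge0//.
by rewrite ler_expR ler_wpM2l.
Qed.

(** Gronwall's lemma in iterated form: the distance of two solutions is halved
    over and over again. *)
Lemma mild_unique_upto u v (T lambda : R) : 0 < T -> 0 <= lambda -> halves T lambda ->
  locally_bounded u -> locally_bounded v ->
  (forall t, 0 < t -> t <= T -> exists y z,
    [/\ integral_terms u t y, integral_terms v t z & u t - y = v t - z]) ->
  forall t, 0 < t -> t <= T -> u t = v t.
Proof.
move=> T0 l0 hT bu bv uv.
have [K HK] := bu T T0; have [L HL] := bv T T0.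
pose B := Num.max (K + L) 0.
have B0 : 0 <= B by rewrite le_max lexx orbT.
have main k t : 0 < t -> t <= T ->
    `|u t - v t| <= B * 2^-1 ^+ k * t `^ (- eps) * expR (lambda * t).
  elim: k t => [|k IH] t t0 tT.
    rewrite expr0 mulr1; apply: (@le_trans _ _ (B * t `^ (- eps))).
      apply: le_trans (ler_normB _ _) _.
      apply: (@le_trans _ _ ((K + L) * t `^ (- eps))).
        by rewrite mulrDl lerD ?HK ?HL.
      by rewrite ler_wpM2r ?powR_ge0// le_max lexx.
    by rewrite ler_peMr ?mulr_ge0 ?powR_ge0// -expR0 ler_expR mulr_ge0// ltW.
  have [y [z [uy vz yz]]] := uv t t0 tT.
  have -> : u t - v t = y - z.
    by apply/eqP; rewrite -subr_eq0 subrACA yz subrr.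
  rewrite exprSr mulrA; apply: (hT t (B * 2^-1 ^+ k) u v) => //.
    by rewrite mulr_ge0// exprn_ge0 ?invr_ge0.
  by move=> tau tau0 taut; apply: IH => //; apply: le_trans tT; exact: ltW.
move=> t t0 tT; apply/eqP; rewrite -subr_eq0 -normr_le0.
apply: (@halving_le0 _ _ (B * t `^ (- eps) * expR (lambda * t))) => k.
apply: le_trans (main k t t0 tT) _.
by rewrite le_eqVlt; apply/orP; left; apply/eqP; ring.
Qed.

Lemma mild_unique u v : locally_bounded u -> locally_bounded v ->
  (forall t, 0 < t -> exists y z,
    [/\ integral_terms u t y, integral_terms v t z & u t - y = v t - z]) ->
  forall t, 0 < t -> u t = v t.
Proof.
move=> bu bv uv t t0; have [lambda l0 hT] := halvesP t0.
by apply: (mild_unique_upto t0 l0 hT bu bv) => // s s0 _; exact: uv.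
Qed.

(** The terms of the Dyson-Phillips series; its partial sums are the Picard
    iterates. *)
Fixpoint picard (u0 : X g) (k : nat) : R -> X alpha :=
  if k is k'.+1 then fun t => \sum_i duhamel alpha i (picard u0 k') t
  else fun t => Sop S alpha t u0.

Definition picard_sum (u0 : X g) (m : nat) (t : R) : X alpha := \sum_(k < m) picard u0 k t.

Definition solution (u0 : X g) (t : R) : X alpha := lim (picard_sum u0 m t @[m --> \oo]).

Lemma admissible_picard (u0 : X g) k : admissible (picard u0 k).
Proof.
elim: k => [|k IH]; last exact: admissible_terms.
split=> [t t0|T T0]; first exact: Sop_continuous.
have [M M0 MS] := smooths_bound hga.1 T0; exists (M * `|u0|) => t t0 tT.
by apply: le_trans (MS t u0 t0 tT) _; rewrite mulrAC.
Qed.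

Lemma admissible_picard_sum (u0 : X g) m : admissible (picard_sum u0 m).
Proof.
elim: m => [|m IH].
  rewrite (_ : picard_sum u0 0 = fun=> 0); first exact: admissible0.
  by apply/funext => t; rewrite /picard_sum big_ord0.
rewrite (_ : picard_sum u0 m.+1 = fun t => 1 *: picard u0 m t + picard_sum u0 m t).
  exact: admissible_lin (admissible_picard u0 m) IH.
by apply/funext => t; rewrite /picard_sum big_ord_recr/= scale1r addrC.
Qed.

Lemma picard_sumS (u0 : X g) m (t : R) : 0 < t ->
  picard_sum u0 m.+1 t =
    Sop S alpha t u0 + \sum_i duhamel alpha i (picard_sum u0 m) t.
Proof.
move=> t0; rewrite /picard_sum big_ord_recl/=; congr (_ + _).
elim: m => [|m IH].
  rewrite big_ord0 big1// => i _.
  rewrite (_ : (fun=> _) = fun=> 0); first exact: duhamel0.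
  by apply/funext => s; rewrite big_ord0.
rewrite big_ord_recr/= {}IH -big_split/=; apply: eq_bigr => i _.
rewrite (_ : (fun s => \sum_(k < m.+1) picard u0 k s) =
    (fun s => 1 *: picard_sum u0 m s + picard u0 m s)); last first.
  by apply/funext => s; rewrite scale1r big_ord_recr.
rewrite (duhamel_lin hrho hP eps0 eps1 i 1 Ra (admissible_picard_sum u0 m)
  (admissible_picard u0 m) t0).
by rewrite scale1r.
Qed.

Lemma picard_le (T lambda : R) : 0 < T -> 0 <= lambda -> halves T lambda ->
  exists2 C : R, 0 <= C & forall (u0 : X g) k t, 0 < t -> t <= T ->
    `|picard u0 k t| <= C * `|u0| * 2^-1 ^+ k * t `^ (- eps) * expR (lambda * t).
Proof.
move=> T0 l0 hT; have [M M0 MS] := smooths_bound hga.1 T0.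
exists M => // u0; elim=> [|k IH] t t0 tT.
  rewrite expr0 mulr1 [X in X * _]mulrAC.
  apply: le_trans (MS t u0 t0 tT) _.
  by rewrite ler_peMr ?mulr_ge0 ?powR_ge0// -expR0 ler_expR mulr_ge0// ltW.
rewrite exprSr mulrA; apply: (terms_norm hT) => //.
- by rewrite !mulr_ge0// exprn_ge0 ?invr_ge0.
- exact: admissible_picard.
- by move=> tau tau0 taut; apply: IH => //; apply: le_trans tT; exact: ltW.
Qed.

(** The series is dominated by a geometric one with ratio one half, locally
    uniformly in [t]; the rate [lambda] depends on [T] while the series does
    not. *)
Lemma solution_tail (T lambda : R) : 0 < T -> 0 <= lambda -> halves T lambda ->
  exists2 C : R, 0 <= C & forall (u0 : X g) m t, 0 < t -> t <= T ->
    `|solution u0 t - picard_sum u0 m t| <=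
      C * `|u0| * 2^-1 ^+ m * t `^ (- eps) * expR (lambda * t).
Proof.
move=> T0 l0 hT; have [C C0 CP] := picard_le T0 l0 hT.
exists (2 * C); first by rewrite mulr_ge0.
move=> u0 m t t0 tT; pose B := C * `|u0| * t `^ (- eps) * expR (lambda * t).
have B0 : 0 <= B by rewrite !mulr_ge0 ?powR_ge0 ?expR_ge0.
have tail l j : `|picard_sum u0 (l + j) t - picard_sum u0 l t| <=
    2 * B * (2^-1 ^+ l - 2^-1 ^+ (l + j)).
  elim: j => [|j IH]; first by rewrite addn0 !subrr normr0 mulr0.
  have -> : picard_sum u0 (l + j.+1) t =
      picard_sum u0 (l + j) t + picard u0 (l + j) t.
    by rewrite addnS /picard_sum big_ord_recr.
  rewrite addrAC; apply: le_trans (ler_normD _ _) _.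
  apply: le_trans (lerD IH (CP u0 (l + j)%N t t0 tT)) _.
  by rewrite addnS exprSr le_eqVlt; apply/orP; left; apply/eqP; rewrite /B; field.
have tail2 l j : `|picard_sum u0 (l + j) t - picard_sum u0 l t| <= 2 * B * 2^-1 ^+ l.
  have B20 : 0 <= 2 * B by apply: mulr_ge0.
  apply: le_trans (tail l j) _; rewrite ler_wpM2l//.
  by rewrite gerBl exprn_ge0 ?invr_ge0.
have c2 : 2 * B * 2^-1 ^+ l @[l --> \oo] --> (0 : R).
  rewrite -[X in _ --> X](mulr0 (2 * B)); apply: cvgM; first exact: cvg_cst.
  by apply: cvg_expr; rewrite ger0_norm ?invr_ge0// invf_lt1// ltr1n.
have cvgs : cvg (picard_sum u0 m t @[m --> \oo]).
  apply/cauchy_cvgP; apply: cauchy_exP => e e0.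
  have [N _ HN] := cvgr_lt 0 c2 e e0.
  exists (picard_sum u0 N t); exists N => // k /= Nk.
  rewrite -ball_normE/= distrC -(subnKC Nk).
  exact: le_lt_trans (tail2 N _) (HN N (leqnn N)).
have sc : `|picard_sum u0 k t - picard_sum u0 m t| @[k --> \oo] -->
    `|solution u0 t - picard_sum u0 m t|.
  by apply: cvg_norm; apply: cvgB; [exact: cvgs|exact: cvg_cst].
rewrite -(cvg_lim _ sc)//; apply: limr_le; first by apply/cvg_ex; eexists; exact: sc.
exists m => // k /= mk; rewrite -(subnKC mk).
apply: le_trans (tail2 m _) _.
by rewrite le_eqVlt; apply/orP; left; apply/eqP; rewrite /B; ring.
Qed.

Lemma solution_le (T : R) : 0 < T -> exists2 C : R, 0 <= C &
  forall (u0 : X g) t, 0 < t -> t <= T -> `|solution u0 t| <= C * `|u0| * t `^ (- eps).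
Proof.
move=> T0; have [lambda l0 hT] := halvesP T0; have [C C0 CP] := solution_tail T0 l0 hT.
exists (C * expR (lambda * T)); first by rewrite mulr_ge0 ?expR_ge0.
move=> u0 t t0 tT; have := CP u0 0%N t t0 tT.
rewrite /picard_sum big_ord0 subr0 expr0 mulr1 => /le_trans; apply.
rewrite [leRHS](_ : _ = C * `|u0| * t `^ (- eps) * expR (lambda * T)); last by ring.
by rewrite ler_wpM2l ?mulr_ge0 ?powR_ge0// ler_expR ler_wpM2l.
Qed.

(** A locally uniform limit of continuous functions. *)
Lemma admissible_solution (u0 : X g) : admissible (solution u0).
Proof.
split=> [t0 t00|T T0]; last first.
  have [C C0 CP] := solution_le T0.
  by exists (C * `|u0|) => t t0 tT; exact: CP.
have T0 : 0 < 2 * t0 by rewrite mulr_gt0.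
have [lambda l0 hT] := halvesP T0; have [C C0 CP] := solution_tail T0 l0 hT.
pose D := C * `|u0| * (t0 / 2) `^ (- eps) * expR (lambda * (2 * t0)).
have D0 : 0 <= D by rewrite !mulr_ge0 ?powR_ge0 ?expR_ge0.
have tailD m t : t0 / 2 < t -> t < 2 * t0 ->
    `|solution u0 t - picard_sum u0 m t| <= D * 2^-1 ^+ m.
  move=> h1 h2; have t_gt0 : 0 < t by apply: lt_trans h1; rewrite divr_gt0.
  apply: le_trans (CP u0 m t t_gt0 (ltW h2)) _.
  rewrite /D [leLHS](_ : _ = C * `|u0| * (t `^ (- eps) * expR (lambda * t)) * 2^-1 ^+ m);
    last by ring.
  rewrite ler_wpM2r ?exprn_ge0 ?invr_ge0// -[leRHS]mulrA ler_wpM2l ?mulr_ge0//.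
  apply: ler_pM; rewrite ?powR_ge0 ?expR_ge0//.
    by apply: powRN_le => //; [rewrite divr_gt0|exact: ltW].
  by rewrite ler_expR ler_wpM2l// ltW.
apply/cvgrPdist_lt => e e0; have e30 : 0 < e / 3 by rewrite divr_gt0.
have c2 : D * 2^-1 ^+ l @[l --> \oo] --> (0 : R).
  rewrite -[X in _ --> X](mulr0 D); apply: cvgM; first exact: cvg_cst.
  by apply: cvg_expr; rewrite ger0_norm ?invr_ge0// invf_lt1// ltr1n.
have [m _ /(_ m (leqnn m)) Hm] := cvgr_lt 0 c2 (e / 3) e30.
have [cs _] := admissible_picard_sum u0 m.
near=> t.
have h1 : t0 / 2 < t by near: t; apply: lt_nbhsr; lra.
have h2 : t < 2 * t0 by near: t; apply: lt_nbhsl; lra.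
have h3 : `|picard_sum u0 m t0 - picard_sum u0 m t| < e / 3.
  by near: t; apply: cvgr_dist_lt => //; exact: cs.
have h4 : `|solution u0 t0 - picard_sum u0 m t0| < e / 3.
  by apply: (le_lt_trans (tailD m t0 _ _)); lra.
have h5 : `|solution u0 t - picard_sum u0 m t| < e / 3.
  exact: (le_lt_trans (tailD m t h1 h2)).
have -> : solution u0 t0 - solution u0 t =
   (solution u0 t0 - picard_sum u0 m t0) - (solution u0 t - picard_sum u0 m t) +
   (picard_sum u0 m t0 - picard_sum u0 m t) by rewrite subrACA subrK.
apply: le_lt_trans (ler_normD _ _) _.
apply: le_lt_trans (lerD (ler_normB _ _) (lexx _)) _; lra.
Unshelve. all: by end_near. Qed.

Lemma solution_eq (u0 : X g) (t : R) : 0 < t ->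
  solution u0 t = Sop S alpha t u0 + \sum_i duhamel alpha i (solution u0) t.
Proof.
move=> t0; have [lambda l0 hT] := halvesP t0; have [C C0 CP] := solution_tail t0 l0 hT.
apply/eqP; rewrite -subr_eq0 -normr_le0.
pose B := C * `|u0| * t `^ (- eps) * expR (lambda * t).
apply: (@halving_le0 _ _ B) => m.
have d1 := CP u0 m.+1 t t0 (lexx t).
have d2 : `|\sum_i duhamel alpha i (solution u0) t -
    \sum_i duhamel alpha i (picard_sum u0 m) t| <=
    C * `|u0| * 2^-1 ^+ m * 2^-1 * t `^ (- eps) * expR (lambda * t).
  apply: (hT t _ (solution u0) (picard_sum u0 m)) => //.
  - by rewrite !mulr_ge0// exprn_ge0 ?invr_ge0.
  - exact: duhamel_terms (admissible_solution u0) t0.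
  - exact: duhamel_terms (admissible_picard_sum u0 m) t0.
  - by move=> tau tau0 taut; apply: CP => //; exact: ltW.
rewrite picard_sumS// in d1.
have -> : solution u0 t - (Sop S alpha t u0 + \sum_i duhamel alpha i (solution u0) t) =
  (solution u0 t - (Sop S alpha t u0 + \sum_i duhamel alpha i (picard_sum u0 m) t)) -
  (\sum_i duhamel alpha i (solution u0) t - \sum_i duhamel alpha i (picard_sum u0 m) t).
  by rewrite opprB !opprD !addrA subrK.
apply: le_trans (ler_normB _ _) _; apply: le_trans (lerD d1 d2) _.
by rewrite exprSr le_eqVlt; apply/orP; left; apply/eqP; rewrite /B; field.
Qed.

Lemma solution_terms (u0 : X g) (t : R) : 0 < t ->
  integral_terms (solution u0) t (solution u0 t - Sop S alpha t u0).
Proof.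
move=> t0; rewrite solution_eq// addrC addKr.
exact: duhamel_terms (admissible_solution u0) t0.
Qed.

Lemma solution_lin (k : R) (u0 v0 : X g) (t : R) : 0 < t ->
  solution (k *: u0 + v0) t = k *: solution u0 t + solution v0 t.
Proof.
have au := admissible_solution u0; have av := admissible_solution v0.
have auv := admissible_lin k au av.
apply: (mild_unique (v := fun s => k *: solution u0 s + solution v0 s)).
- by have [] := admissible_solution (k *: u0 + v0).
- by have [] := auv.
- move=> s s0; exists (solution (k *: u0 + v0) s - Sop S alpha s (k *: u0 + v0)).
  exists (\sum_i duhamel alpha i (fun s => k *: solution u0 s + solution v0 s) s).
  split; [exact: solution_terms|exact: duhamel_terms|].
  have -> : \sum_i duhamel alpha i (fun s => k *: solution u0 s + solution v0 s) s =
      k *: (\sum_i duhamel alpha i (solution u0) s) +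
      \sum_i duhamel alpha i (solution v0) s.
    rewrite scaler_sumr -big_split/=; apply: eq_bigr => i _.
    exact: (duhamel_lin hrho hP eps0 eps1 i k Ra au av s0).
  rewrite subKr (Sop_linear hga.1 s0) (solution_eq u0 s0) (solution_eq v0 s0).
  by rewrite scalerDr addrACA addrK.
Qed.

(** The series is a mild solution, and uniqueness among strongly measurable
    functions makes it the one selected by the perturbed family. *)
Lemma perturbedE (u0 : X g) (t : R) : 0 < t ->
  perturbed S P t u0 = emb X alpha (solution u0 t).
Proof.
move=> t0; rewrite /perturbed gt_eqF//; congr (emb X alpha _).
have msol : mild_solution S P u0 (solution u0).
  split.
    split.
      by apply: continuous_strongly_measurable; have [] := admissible_solution u0.
    move=> T T0; have [C C0 CP] := solution_le T0.
    apply: (@le_lt_trans _ _ (C * `|u0|)%:E); last exact: ltry.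
    apply: ge_ereal_sup => _ [s /= /andP[s0 sT] <-]; rewrite lee_fin.
    rewrite mulrC -ler_pdivlMr ?powR_gt0// -powRN; exact: CP.
  move=> s s0; exists (fun i => duhamel alpha i (solution u0) s); split.
    move=> i; exists (kernel alpha i s (solution u0)).
      move=> tau /=; rewrite in_itv/= => /andP[tau0 taus].
      have [[sm _] _ _] := R_setsP i Ra.
      by rewrite /kernel SopE// subr_gt0.
    exact: (duhamel_bochner hrho hP eps0 eps1 i Ra (admissible_solution u0) s0).
  by rewrite {1}solution_eq// linearD linear_sum SopE//; exact: hga.1.
have [[_ ub] umild] := @xgetI _ (fun=> 0) (mild_solution S P u0) _ msol.
set v := xget _ _ in ub umild *.
apply: mild_unique t0; last first.
- move=> s s0; have [w [wint wE]] := umild s s0.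
  exists (\sum_i w i), (solution u0 s - Sop S alpha s u0).
  split; [|exact: solution_terms|].
    have [f fP] := choice (fun i => let: ex_intro2 f fE fw := wint i in
      ex_intro (fun f => _ /\ _) f (conj fE fw)).
    exists w, f; split=> // i; first by have [] := fP i.
    move=> tau tau0 taus; have [fE _] := fP i.
    apply: (@emb_inj R X alpha); rewrite fE; last by rewrite /= in_itv/= tau0.
    have [[sm _] _ _] := R_setsP i Ra.
    by rewrite /kernel SopE// subr_gt0.
  rewrite subKr; apply: (@emb_inj R X alpha).
  by rewrite linearB wE linear_sum addrK SopE//; exact: hga.1.
- by have [] := admissible_solution u0.
- move=> T T0; move: (ub T T0); set E := ereal_sup _ => Efin.
  exists (fine E) => s s0 sT.
  have sE : ((s `^ eps * `|v s|)%:E <= E)%E.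
    by apply: ereal_sup_ubound; exists s => //=; rewrite s0.
  have Ef : E \is a fin_num.
    by rewrite fin_numE; apply/andP; split; apply/eqP => E0; rewrite E0 in Efin sE.
  by rewrite powRN ler_pdivlMr ?powR_gt0// mulrC -lee_fin fineK.
Qed.

End MildSolution.

(** * The perturbed semigroup *)

Section PerturbedSemigroup.
Context {R : realType} {X : banach_scale R} {S : op_family X}.
Context {alpha : scale_index X} {rho : R} {n : nat} {beta : 'I_n -> scale_index X}.
Context {P : forall i, {linear X alpha -> X (beta i)}}.
Hypotheses (hrho : 0 <= rho) (hn : (0 < n)%N) (hS : semigroup_in_scale S).
Hypothesis hP : forall i, pert_class S alpha (beta i) rho (P i).
Context {g : scale_index X}.
Hypotheses (hg : E_set S alpha g) (Rg : R_sets S beta g).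

Local Notation eps := (dreg alpha g).
Local Notation kernel := (@kernel R X S alpha n beta P).
Local Notation duhamel := (@duhamel R X S alpha n beta P).
Local Notation solution := (@solution R X S alpha n beta P g).
Local Notation SP := (@perturbed R X S alpha n beta P g).
Implicit Types (h : scale_index X) (i : 'I_n).

Let eps0 : 0 <= eps.
Proof. by have [] := hg; rewrite in_itv/= => /andP[_]; rewrite subr_ge0. Qed.

Let eps1 : eps < 1.
Proof. by have [] := hg; rewrite in_itv/= => /andP[? _] _; rewrite /dreg; lra. Qed.

Let hga : csmooths S g alpha.
Proof. by have [] := hg. Qed.

Let Ra : R_sets S beta alpha := R_sets_alpha hP.

Let asol u0 := admissible_solution hrho hn hP hg u0.

Let hgg : csmooths S g g.
Proof. by have [_] := hS g. Qed.

(** The perturbed evolution with values in [X h]; in the ambient space it does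
    not depend on [h]. *)
Definition perturbed_in h (t : R) (u0 : X g) : X h :=
  Sop S h t u0 + \sum_i duhamel h i (solution u0) t.

Lemma perturbed_inE h (t : R) (u0 : X g) : smooths S g h -> R_sets S beta h ->
  0 < t -> emb X h (perturbed_in h t u0) = SP t u0.
Proof.
move=> sm Rh t0; rewrite (perturbedE hrho hn hP hg)// (solution_eq hrho hn hP hg)//.
rewrite !linearD !linear_sum SopE// SopE//; last exact: hga.1.
congr (_ + _); apply: eq_bigr => i _.
exact: (duhamel_consistent hrho hP eps0 eps1 i Rh (asol u0) t0).
Qed.

Lemma perturbed_in_linear h (t : R) : smooths S g h -> R_sets S beta h -> 0 < t ->
  linear (perturbed_in h t).
Proof.
move=> sm Rh t0 k u0 v0; apply: (@emb_inj R X h).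
rewrite linearP !perturbed_inE// !(perturbedE hrho hn hP hg)//.
by rewrite (solution_lin hrho hn hP hg)// linearP.
Qed.

(** The integral term is smaller than the free evolution by a positive power of
    [t], because the perturbation loses less than one unit of regularity. *)
Lemma duhamel_solution_le h i (T : R) : R_sets S beta h -> 0 < T ->
  exists2 C : R, 0 <= C & forall (u0 : X g) t, 0 < t -> t <= T ->
    `|duhamel h i (solution u0) t| <=
      C * t `^ (- dreg h g) * t `^ (1 - dreg alpha (beta i)) * `|u0|.
Proof.
move=> Rh T0; have [_ d0 d1] := R_setsP i Rh.
have [M M0 MP] := kernel_integrand hrho hP (eps := eps) i Rh T0.
have [C C0 CP] := solution_le hrho hn hP hg T0.
have b0 : 0 <= beta_bound (dreg h (beta i)) eps.
  by rewrite /beta_bound addr_ge0// divr_ge0// subr_ge0 ltW.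
exists (M * C * beta_bound (dreg h (beta i)) eps); first by rewrite !mulr_ge0.
move=> u0 t t0 tT.
have bi : beta_integrand (dreg h (beta i)) eps 0 t (M * (C * `|u0|))
    (kernel h i t (solution u0)).
  apply: MP => // tau tau0 taut; first by have [+ _] := asol u0; apply.
  by apply: CP => //; apply: le_trans tT; exact: ltW.
apply: le_trans (integral_lim_le d0 d1 eps0 eps1 t0 bi) _.
rewrite subr0 (_ : 1 - dreg h (beta i) - eps =
    - dreg h g + (1 - dreg alpha (beta i))); last by rewrite /dreg; ring.
rewrite powRD ?(gt_eqF t0) ?implybT//.
by rewrite le_eqVlt; apply/orP; left; apply/eqP; ring.
Qed.

Lemma perturbed_in_le h (T : R) : smooths S g h -> R_sets S beta h -> 0 < T ->
  exists2 C : R, 0 <= C & forall (u0 : X g) t, 0 < t -> t <= T ->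
    `|perturbed_in h t u0| <= C * t `^ (- dreg h g) * `|u0|.
Proof.
move=> sm Rh T0; have [M M0 MS] := smooths_bound sm T0.
have [C CP] := choice (fun i => let: ex_intro2 C C0 CP := duhamel_solution_le i Rh T0 in
  ex_intro (fun C => 0 <= C /\ _) C (conj C0 CP)).
pose D i := C i * T `^ (1 - dreg alpha (beta i)).
have D0 i : 0 <= D i by have [? _] := CP i; rewrite mulr_ge0// powR_ge0.
exists (M + \sum_i D i); first by rewrite addr_ge0// sumr_ge0.
move=> u0 t t0 tT; apply: le_trans (ler_normD _ _) _.
rewrite !mulrDl; apply: lerD; first exact: MS.
rewrite !mulr_suml.
apply: le_trans (ler_norm_sum _ _ _) _; apply: ler_sum => i _.
have [C0 Ci] := CP i; apply: le_trans (Ci u0 t t0 tT) _.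
rewrite /D [X in _ <= X * _]mulrAC ler_wpM2r// ler_wpM2l ?mulr_ge0 ?powR_ge0//.
have [_ _ a1] := R_setsP i Ra.
by apply: ge0_ler_powR; rewrite ?nnegrE ?subr_ge0//; exact: ltW.
Qed.

Lemma perturbed_in_bounded h (T : R) : smooths S g h -> R_sets S beta h -> 0 < T ->
  exists2 C : R, 0 <= C & forall t, 0 < t -> t <= T ->
    op_bounded h (SP t) (C / t `^ dreg h g).
Proof.
move=> sm Rh T0; have [C C0 CP] := perturbed_in_le sm Rh T0; exists C => // t t0 tT.
rewrite -powRN; apply: (op_bounded_intro (A := perturbed_in h t)).
- exact: perturbed_in_linear.
- by rewrite mulr_ge0// powR_ge0.
- by move=> u; exact: perturbed_inE.
- by move=> u; exact: CP.
Qed.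

Lemma duhamel_solution_cvg0 (u0 : X g) :
  \sum_i duhamel g i (solution u0) t @[t --> 0^'+] --> (0 : X g).
Proof.
rewrite -[X in _ --> X](_ : \sum_(i < n) 0 = 0); last by rewrite big1.
apply: (cvg_sum_ord (f := fun i => duhamel g i (solution u0))) => i.
have [C C0 CP] := duhamel_solution_le i Rg ltr01.
have [_ _ a1] := R_setsP i Ra.
have c0 : C * `|u0| * t `^ (1 - dreg alpha (beta i)) @[t --> 0^'+] --> (0 : R).
  rewrite -[X in _ --> X](mulr0 (C * `|u0|)); apply: cvgM; first exact: cvg_cst.
  by apply: powR_cvg0; rewrite subr_gt0.
apply/cvgrPdist_lt => e e0; near=> t.
have t0 : 0 < t by near: t; exact: nbhs_right_gt.
have t1 : t <= 1 by near: t; apply: nbhs_right_le.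
rewrite sub0r normrN; apply: le_lt_trans (CP u0 t t0 t1) _.
rewrite {1}/dreg subrr oppr0 powRr0 mulr1 mulrAC.
by near: t; exact: cvgr_lt c0 e e0.
Unshelve. all: by end_near. Qed.

(** A translate of a solution is the solution issued from its value at the new
    initial time: the Duhamel integral is split there, and [S t] is taken out
    of the first part. *)
Lemma solution_shift (u0 : X g) (t s : R) : 0 < t -> 0 < s ->
  solution (perturbed_in g s u0) t = solution u0 (t + s).
Proof.
move=> t0 s0; have [cs bs] := asol u0.
have av : admissible (alpha := alpha) (eps := eps) (fun t => solution u0 (t + s)).
  split=> [t1 t10|T T0].
    apply: (@continuous_comp _ _ _ (fun t => t + s) (solution u0)).
      by apply: cvgD; [exact: cvg_id|exact: cvg_cst].
    by apply: cs; rewrite addr_gt0.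
  have [C C0 CP] := solution_le hrho hn hP hg (addr_gt0 T0 s0).
  exists (C * `|u0|) => t1 t10 t1T.
  apply: le_trans (CP u0 (t1 + s) _ _) _; [by rewrite addr_gt0|by rewrite lerD2r|].
  by rewrite ler_wpM2l ?mulr_ge0// powRN_le// lerDl ltW.
apply: (mild_unique hrho hn hP hg (v := fun t => solution u0 (t + s))) t0.
- by have [] := asol (perturbed_in g s u0).
- by have [] := av.
move=> {}t t0.
exists (solution (perturbed_in g s u0) t - Sop S alpha t (perturbed_in g s u0)).
exists (\sum_i duhamel alpha i (fun t => solution u0 (t + s)) t).
split; [exact: (solution_terms hrho hn hP hg)|exact: (duhamel_terms hrho hP hg av t0)|].
rewrite subKr; apply/eqP; rewrite eq_sym subr_eq; apply/eqP.
have ts0 : 0 < t + s by rewrite addr_gt0.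
rewrite (solution_eq hrho hn hP hg)// (Sop_add hS alpha u0 hgg.1 t0 s0).
have [A AE] := linear_mapE (Sop_linear hga.1 t0).
have cA : continuous A.
  have [M M0 MS] := smooths_bound hga.1 t0.
  apply: (bounded_linear_continuous (c := M * t `^ (- dreg alpha g))) => u.
  by rewrite AE MS.
rewrite -!AE /perturbed_in linearD linear_sum -addrA; congr (_ + _).
rewrite -big_split; apply: eq_bigr => i _ /=.
have [_ d0 d1] := R_setsP i Rg; have [_ e0 e1] := R_setsP i Ra.
have [[smg _] _ _] := R_setsP i Rg.
have [K HK] := admissible_integrand hrho hP i Ra (asol u0) ts0.
have [L HL] := admissible_integrand hrho hP i Rg (asol u0) s0.
rewrite {1}/duhamel (integral_lim_split e0 e1 eps0 eps1 s0 _ HK); last first.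
  by rewrite ltrDr.
congr (_ + _).
  rewrite /duhamel -(integral_lim_linear_map d0 d1 eps0 eps1 cA s0 HL).
  apply: eq_integral_lim => // tau tau0 taus; rewrite /= AE /kernel.
  by rewrite -addrA (Sop_add hS alpha _ smg t0)// subr_gt0.
rewrite /duhamel -[X in integral_lim _ X _](addr0 s) [t + s]addrC.
rewrite -integral_lim_shift; apply: eq_integral_lim => // tau _ _.
by rewrite /kernel opprD addrACA subrr add0r [s + tau]addrC.
Qed.

Lemma perturbed_add h (t s : R) (u0 : X g) : smooths S g h -> R_sets S beta h ->
  0 < t -> 0 < s -> perturbed_in h (t + s) u0 = perturbed_in h t (perturbed_in g s u0).
Proof.
move=> sm Rh t0 s0; apply: (@emb_inj R X h); rewrite !perturbed_inE ?addr_gt0//.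
by rewrite !(perturbedE hrho hn hP hg) ?addr_gt0// solution_shift.
Qed.

Definition perturbed_op (t : R) (u0 : X g) : X g :=
  if t == 0 then u0 else perturbed_in g t u0.

Lemma perturbed_opE (t : R) (u0 : X g) : 0 <= t -> emb X g (perturbed_op t u0) = SP t u0.
Proof.
rewrite le_eqVlt /perturbed_op eq_sym => /predU1P[->|t0].
  by rewrite eqxx /perturbed eqxx.
by rewrite gt_eqF// perturbed_inE//; exact: hgg.1.
Qed.

Lemma perturbed_op_linear (t : R) : 0 <= t -> linear (perturbed_op t).
Proof.
rewrite le_eqVlt eq_sym => /predU1P[->|t0] k u v; rewrite /perturbed_op.
  by rewrite eqxx.
by rewrite gt_eqF// perturbed_in_linear//; exact: hgg.1.
Qed.

Lemma perturbed_op_add (t s : R) (u0 : X g) : 0 <= t -> 0 <= s ->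
  perturbed_op (t + s) u0 = perturbed_op t (perturbed_op s u0).
Proof.
rewrite le_eqVlt eq_sym => /predU1P[->|t0]; first by rewrite add0r /perturbed_op eqxx.
rewrite le_eqVlt eq_sym => /predU1P[->|s0].
  by rewrite addr0 [perturbed_op 0 _]/perturbed_op eqxx.
rewrite /perturbed_op !gt_eqF ?addr_gt0//.
exact: (perturbed_add u0 hgg.1).
Qed.

(** The bound on the unit time interval is iterated by the semigroup property. *)
Lemma perturbed_op_growth : exists2 M : R, 1 <= M & forall (t : R) (u0 : X g), 0 <= t ->
  `|perturbed_op t u0| <= M * expR (ln M * t) * `|u0|.
Proof.
have [C C0 CP] := perturbed_in_le hgg.1 Rg ltr01.
pose M := Num.max C 1; have M1 : 1 <= M by rewrite le_max lexx orbT.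
have M0 : 0 < M by exact: lt_le_trans M1.
have unit_bound t u0 : 0 <= t -> t <= 1 -> `|perturbed_op t u0| <= M * `|u0|.
  rewrite le_eqVlt eq_sym /perturbed_op => /predU1P[->|t0] t1.
    by rewrite eqxx ler_peMl.
  rewrite gt_eqF//; apply: le_trans (CP u0 t t0 t1) _.
  by rewrite {1}/dreg subrr oppr0 powRr0 mulr1 ler_wpM2r// le_max lexx.
have iter_bound k t u0 : 0 <= t -> t <= k.+1%:R -> `|perturbed_op t u0| <= M ^+ k.+1 * `|u0|.
  elim: k t u0 => [|k IH] t u0 t0 tk; first by rewrite expr1 unit_bound.
  have [t1|t1] := lerP t k.+1%:R.
    apply: le_trans (IH t u0 t0 t1) _.
    by rewrite ler_wpM2r// [leRHS]exprS ler_peMl// exprn_ge0// ltW.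
  have kk : k.+2%:R = 1 + k.+1%:R :> R by rewrite -natr1 addrC.
  have -> : t = 1 + (t - 1) by rewrite addrC subrK.
  have k1 : 1 <= k.+1%:R :> R by rewrite ler1n.
  rewrite perturbed_op_add//; last by rewrite subr_ge0; lra.
  apply: le_trans (unit_bound 1 _ ler01 (lexx 1)) _.
  rewrite exprS -mulrA ler_wpM2l ?(ltW M0)//; apply: IH; lra.
exists M => // t u0 t0.
have /andP[m1 m2] := truncn_itv t0; set m := Num.truncn t in m1 m2.
apply: le_trans (iter_bound m t u0 t0 (ltW m2)) _.
rewrite ler_wpM2r// exprS ler_wpM2l ?(ltW M0)//.
rewrite -{1}(lnK (x := M)) ?posrE// -expRM_natl ler_expR mulrC.
by rewrite ler_wpM2l// ln_ge0.
Qed.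

Lemma perturbed_semigroup : semigroup_in SP.
Proof.
have [M M1 MP] := perturbed_op_growth.
have ex t : exists A : {linear X g -> X g}, 0 <= t -> forall u, A u = perturbed_op t u.
  have [t0|t0] := boolP (0 <= t).
    by have [A AE] := linear_mapE (perturbed_op_linear t0); exists A.
  by exists \0.
have [A AE] := choice ex; exists A; split.
- move=> t t0; apply: (bounded_linear_continuous (c := M * expR (ln M * t))) => u.
  by rewrite AE// MP.
- by move=> t u t0; rewrite AE// perturbed_opE.
- by move=> u; rewrite AE// /perturbed_op eqxx.
- by move=> t s u t0 s0; rewrite !AE ?addr_ge0// perturbed_op_add.
Qed.

End PerturbedSemigroup.

Lemma op_bounded_ge0 {R : realType} {X : banach_scale R} (g g' : scale_index X)
    (F : X g -> ambient X) (c : R) : op_bounded g' F c -> 0 <= c.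
Proof. by move=> [A [_ _ /opnorm_ge0]]. Qed.

Lemma op_bounded_le {R : realType} {X : banach_scale R} (g g' : scale_index X)
    (F : X g -> ambient X) (c d : R) : c <= d -> op_bounded g' F c -> op_bounded g' F d.
Proof.
move=> cd [A [AF cA Ac]]; exists A; split=> //.
by apply: le_trans Ac _; rewrite lee_fin.
Qed.

(** An exponential bound for large times and a power bound for small times
    combine into one bound at any larger exponential rate. *)
Lemma op_bounded_all_times {R : realType} {X : banach_scale R} (g g' : scale_index X)
    (F : R -> X g -> ambient X) (d omega omega' M : R) :
  0 <= d -> d <= 1 -> omega < omega' ->
  (forall t, 0 < t -> t <= 1 -> op_bounded g' (F t) (M / t `^ d)) ->
  (forall t, 1 < t -> op_bounded g' (F t) (M * expR (omega * t))) ->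
  exists M1 : R, forall t, 0 < t ->
    op_bounded g' (F t) (M1 / t `^ d * expR (omega' * t)).
Proof.
move=> d0 d1 ww F1 F2.
have M0 : 0 <= M.
  have := op_bounded_ge0 (F1 1 ltr01 (lexx 1)).
  by rewrite pmulr_lge0// invr_gt0 powR_gt0.
have dw : 0 < omega' - omega by rewrite subr_gt0.
(* The first summand covers [t <= 1], the second one [1 < t], where
   [t `^ d <= t <= expR ((omega' - omega) * t) / (omega' - omega)]. *)
exists (M * expR `|omega'| + M / (omega' - omega)) => t t0.
have td : 0 < t `^ d by exact: powR_gt0.
have p1 : 0 <= M * expR `|omega'| by rewrite mulr_ge0// expR_ge0.
have p2 : 0 <= M / (omega' - omega) by rewrite divr_ge0// ltW.
have [t1|t1] := lerP t 1.
  apply: op_bounded_le (F1 t t0 t1).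
  rewrite mulrAC ler_wpM2r ?invr_ge0 ?(ltW td)//.
  apply: (@le_trans _ _ (M * expR `|omega'| * expR (omega' * t))); last first.
    by rewrite ler_wpM2r ?expR_ge0// lerDl.
  rewrite -mulrA ler_peMr// -expRD -[leLHS]expR0 ler_expR.
  have : - (`|omega'| * 1) <= omega' * t.
    rewrite lerNl; apply: le_trans (ler_norm _) _.
    by rewrite normrN normrM (gtr0_norm t0) ler_wpM2l.
  by rewrite mulr1; lra.
apply: op_bounded_le (F2 t t1).
have tt : t `^ d <= t by rewrite ler1_powR// ltW.
have te : t <= (omega' - omega)^-1 * expR ((omega' - omega) * t).
  rewrite mulrC ler_pdivlMr// mulrC.
  by apply: le_trans (expR_ge1Dx _); rewrite lerDr.
have -> : omega' * t = omega * t + (omega' - omega) * t by ring.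
rewrite expRD; apply: (@le_trans _ _ (M / (omega' - omega) / t `^ d *
    (expR (omega * t) * expR ((omega' - omega) * t)))); last first.
  rewrite ler_wpM2r ?mulr_ge0 ?expR_ge0// ler_wpM2r ?invr_ge0 ?(ltW td)//.
  by rewrite lerDr.
rewrite [leRHS](_ : _ = M * expR (omega * t) *
  ((omega' - omega)^-1 * expR ((omega' - omega) * t) / t `^ d)); last by ring.
rewrite ler_peMr ?mulr_ge0 ?expR_ge0// ler_pdivlMr// mul1r.
exact: le_trans tt te.
Qed.

Theorem theorem6p15 (R : realType) (X : banach_scale R) (S : op_family X)
    (alpha : scale_index X) (rho : R) (n : nat) (beta : 'I_n -> scale_index X)
    (P : forall i, {linear X alpha -> X (beta i)})
    (hrho : 0 < rho) (hn : (0 < n)%N)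
    (hS : semigroup_in_scale S)
    (hP : forall i, pert_class S alpha (beta i) rho (P i)) :
  [/\ Sigmas S alpha beta =
        \bigcap_(i in [set: 'I_n]) Sigma S alpha (beta i),
      Sigmas S alpha beta =
        \bigcap_(i in [set: 'I_n])
          [set g | [/\ csmooths S (beta i) g, csmooths S g alpha &
                       rindex g \in `[rindex (beta i), rindex alpha]]],
      Sigmas S alpha beta alpha &
      forall g, Sigmas S alpha beta g ->
        let SP := @perturbed R X S alpha n beta P g in
        semigroup_in SP /\
        exists M0 omega : R,
          [/\ forall t : R, 0 <= t -> op_bounded g (SP t) (M0 * expR (omega * t)),
              forall u0 : X g, exists2 f : R -> X g,
                forall t : R, 0 < t -> emb X g (f t) = SP t u0 - S g t u0 &
                `|f t| @[t --> 0^'+] --> (0 : R),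
              forall g', R_sets S beta g' -> smooths S g g' ->
                forall T : R, 0 < T -> exists M : R,
                  (forall t : R, 0 < t -> t <= T ->
                     op_bounded g' (SP t) (M / t `^ dreg g' g)) /\
                  (forall t : R, T < t ->
                     op_bounded g' (SP t) (M * expR (omega * t))) &
              forall g', R_sets S beta g' -> smooths S g g' ->
                forall omega' : R, omega < omega' -> exists M1 : R,
                  forall t : R, 0 < t ->
                    op_bounded g' (SP t)
                      (M1 / t `^ dreg g' g * expR (omega' * t))]].
Proof.
have rho0 := ltW hrho; pose i0 := Ordinal hn.
split.
- apply/seteqP; split=> [g [Eg Rg] i _|g Sg]; first by split=> //; exact: Rg.
  by split=> [|i _]; [have [] := Sg i0 I|have [] := Sg i I].
- apply/seteqP; split=> [g [[gI ga] Rg] i _|g Sg].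
    have [gR bg] := Rg i I; split=> //.
    by move: gI gR; rewrite !in_itv/= => /andP[_ ->] /andP[->].
  split=> [|i _].
    have [_ ga] := Sg i0 I; have [/andP[_ d1] _ _ _] := hP i0.
    rewrite in_itv/= => /andP[h1 h2]; split=> //.
    by move: d1; rewrite in_itv/= h2 andbT /dreg => ?; lra.
  have [bg _] := Sg i I; have [/andP[_ d1] _ _ _] := hP i.
  rewrite in_itv/= => /andP[h1 h2]; split=> //.
  by move: d1; rewrite in_itv/= h1 /dreg => ?; lra.
- split; last exact: (R_sets_alpha hP).
  have [_ aa] := hS alpha; split=> //.
  by rewrite in_itv/= lexx andbT; lra.
move=> g [Eg Rg] SP.
have [_ [sgg cgg]] := hS g.
split; first exact: (perturbed_semigroup rho0 hn hS hP Eg Rg).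
have [M M1 MP] := perturbed_op_growth rho0 hn hS hP Eg Rg.
have M0 : 0 <= M by exact: le_trans M1.
have growth (t : R) : 0 <= t -> op_bounded g (SP t) (M * expR (ln M * t)).
  move=> t0; apply: (op_bounded_intro (A := perturbed_op (P := P) (S := S) (g := g) t)).
  - exact: (perturbed_op_linear rho0 hn hS hP Eg Rg).
  - by rewrite mulr_ge0// expR_ge0.
  - by move=> u; exact: (perturbed_opE rho0 hn hS hP Eg Rg).
  - by move=> u; exact: MP.
have smoothing g' (Rg' : R_sets S beta g') (sm : smooths S g g') (T : R) : 0 < T ->
    exists M' : R,
      (forall t : R, 0 < t -> t <= T -> op_bounded g' (SP t) (M' / t `^ dreg g' g)) /\
      (forall t : R, T < t -> op_bounded g' (SP t) (M' * expR (ln M * t))).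
  move=> T0; have [C C0 CP] := perturbed_in_le rho0 hn hP Eg sm Rg' T0.
  have [D D0 DP] := perturbed_in_bounded rho0 hn hP Eg sm Rg' T0.
  (* For [T < t] the last stretch of length [T] smooths into [X g'], and the time
     before it is spent in [X g]. *)
  pose B := C * T `^ (- dreg g' g) * M.
  have B0 : 0 <= B by rewrite !mulr_ge0// powR_ge0.
  exists (D + B); split=> [t t0 tT|t Tt].
    apply: op_bounded_le (DP t t0 tT).
    by rewrite ler_wpM2r ?invr_ge0 ?powR_ge0// lerDl.
  have t0 : 0 < t by exact: lt_trans Tt.
  have tT0 : 0 < t - T by rewrite subr_gt0.
  apply: (op_bounded_le (c := B * expR (ln M * t))).
    by rewrite ler_wpM2r ?expR_ge0// lerDr.
  apply: (op_bounded_intro (A := perturbed_in (S := S) (P := P) g' t)).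
  - exact: (perturbed_in_linear rho0 hn hP Eg sm Rg' t0).
  - by rewrite mulr_ge0// expR_ge0.
  - by move=> u; exact: (perturbed_inE rho0 hn hP Eg).
  - move=> u; have -> : t = T + (t - T) by rewrite addrC subrK.
    rewrite (perturbed_add rho0 hn hS hP Eg Rg u sm Rg' T0 tT0).
    apply: le_trans (CP _ T T0 (lexx T)) _.
    have := MP (t - T) u (ltW tT0); rewrite /perturbed_op (gt_eqF tT0) => H.
    rewrite /B -!mulrA ler_wpM2l// ler_wpM2l ?powR_ge0//.
    apply: le_trans H _; rewrite -mulrA ler_wpM2l// ler_wpM2r// ler_expR.
    by rewrite ler_wpM2l ?ln_ge0// lerDr ltW.
exists M, (ln M); split=> //.
- move=> u0; exists (fun t =>
    \sum_i duhamel (S := S) (P := P) g i (solution (S := S) (P := P) u0) t).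
    move=> t t0; rewrite /SP -(perturbed_inE rho0 hn hP Eg u0 sgg Rg t0).
    by rewrite /perturbed_in linearD SopE// addrC addKr.
  rewrite -[X in _ --> X](@normr0 _ (X g)).
  by apply: cvg_norm; exact: (duhamel_solution_cvg0 rho0 hn hP Eg Rg).
- move=> g' Rg' sm omega' ww; have [M' [F1 F2]] := smoothing g' Rg' sm 1 ltr01.
  have [d0 _] := sm.
  apply: (op_bounded_all_times d0 _ ww F1 F2).
  have [_ _ d1] := R_setsP i0 Rg'; have [_ d2 _] := R_setsP i0 Rg.
  by move: d1 d2; rewrite /dreg; lra.
Qed.
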